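(* Let $0<r\le1$, $0\le\rho,\delta\le1$, and $k\in\mathbb{N}$ with $k>\frac n2$. Let $a\in S^m_{\rho,\delta,0,2k}(\mathbb{T}^n\times\mathbb{Z}^n)$. Let $X^{(n)}$ be either $L^p(\mathbb{T}^n)$ with $1\le p\le2$, or, when $n=1$, $X^{(1)}=B^s_{\infty,\infty}(\mathbb{T})$ with $0<s<1$. Assume $0\le w_2<2k-n$, $m<-\frac nr-w_2-2k\delta$, $1\le p_2\le\infty$, $1\le q_2\le\infty$. Then $T_a:X^{(n)}\to B^{w_2}_{p_2,q_2}(\mathbb{T}^n)$ is $r$-nuclear.
   Context: Toroidal Fourier transform $\widehat f(\xi)=\int_{\mathbb{T}^n}e^{-i2\pi x\cdot\xi}f(x)dx$, $\langle\xi\rangle=(1+|\xi|^2)^{1/2}$. $S^m_{\rho,\delta,0,\mu}(\mathbb{T}^n\times\mathbb{Z}^n)$: functions $a(x,\xi)$ smooth in $x$ for each $\xi\in\mathbb{Z}^n$ with $|\partial_x^\beta a(x,\xi)|\le C_\beta\langle\xi\rangle^{m+\delta|\beta|}$ for $|\beta|\le\mu$. $T_au(x)=\sum_{\xi\in\mathbb{Z}^n}e^{i2\pi x\cdot\xi}a(x,\xi)\widehat u(\xi)$. Periodic Besov spaces: $\|f\|_{B^w_{p,q}}=\big(\sum_{m\ge0}2^{mwq}\|\sum_{2^m\le|\xi|<2^{m+1}}e^{i2\pi x\cdot\xi}\widehat f(\xi)\|^q_{L^p(\mathbb{T}^n)}\big)^{1/q}$, and for $q=\infty$, $\|f\|_{B^w_{p,\infty}}=\sup_{m\in\mathbb{N}}2^{mw}\|\sum_{2^m\le|\xi|<2^{m+1}}e^{i2\pi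 x\cdot\xi}\widehat f(\xi)\|_{L^p(\mathbb{T}^n)}$. The paper identifies $B^s_{\infty,\infty}(\mathbb{T})$, $0<s<1$, with the Hölder space $\Lambda^s(\mathbb{T})$ normed by $\sup_{x,h}|f(x+h)-f(x)||h|^{-s}+\sup_x|f(x)|$. $T:E\to F$ is $r$-nuclear if $T=\sum_ne'_n(\cdot)y_n$ with $\sum_n\|e'_n\|^r_{E'}\|y_n\|^r_F<\infty$. *)

(* Defs.v *)
From HB Require Import structures.
From mathcomp Require Import all_boot all_order all_algebra.
From mathcomp Require Import complex.
From mathcomp Require Import all_classical all_reals all_analysis.
Set Implicit Arguments.
Unset Strict Implicit.
Unset Printing Implicit Defensive.
Import Order.TTheory GRing.Theory Num.Theory numFieldNormedType.Exports.
Local Open Scope classical_set_scope.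
Local Open Scope ring_scope.

Section Defs.
Variable R : realType.

(* Points of R^n are row vectors; functions on T^n = R^n/Z^n are represented
   by Z^n-periodic functions on R^n with values in C = R[i]. *)
Definition fn (n : nat) := 'rV[R]_n -> R[i].

Definition cabs (z : R[i]) : R := Num.sqrt (complex.Re z ^+ 2 + complex.Im z ^+ 2).

Definition cexpi (t : R) : R[i] := (cos t +i* sin t)%C.

Definition rowofT (n : nat) (t : n.-tuple R) : 'rV[R]_n := \row_i tnth t i.

(* Lebesgue integral over the unit cube [0,1]^k, written as an iterated
   integral (Fubini/Tonelli) of one-dimensional Lebesgue integrals. *)
Fixpoint cubeint (k : nat) : (k.-tuple R -> R) -> R :=
  match k with
  | 0 => fun F => F [tuple]
  | k'.+1 => fun F => Rintegral (@lebesgue_measure R) `[0%R, 1%R]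
                        (fun t => cubeint (fun y => F [tuple of t :: y]))
  end.

Fixpoint cubeintE (k : nat) : (k.-tuple R -> \bar R) -> \bar R :=
  match k with
  | 0 => fun F => F [tuple]
  | k'.+1 => fun F => (\int[@lebesgue_measure R]_(t in `[0%R, 1%R])
                        cubeintE (fun y => F [tuple of t :: y]))%E
  end.

Definition Tint (n : nat) (f : fn n) : R[i] :=
  (cubeint (fun t => complex.Re (f (rowofT t))) +i* cubeint (fun t => complex.Im (f (rowofT t))))%C.

Definition dotZ (n : nat) (x : 'rV[R]_n) (xi : 'rV[int]_n) : R :=
  \sum_i x 0 i * (xi 0 i)%:~R.

Definition echar (n : nat) (xi : 'rV[int]_n) (x : 'rV[R]_n) : R[i] :=
  cexpi (2 * pi * dotZ x xi).

Definition fourier (n : nat) (f : fn n) (xi : 'rV[int]_n) : R[i] :=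
  Tint (fun x => cexpi (- (2 * pi * dotZ x xi)) * f x).

Definition normsqZ (n : nat) (xi : 'rV[int]_n) : int := \sum_i (xi 0 i) ^+ 2.
Definition jbr (n : nat) (xi : 'rV[int]_n) : R := Num.sqrt (1 + (normsqZ xi)%:~R).

Definition boxpt (n N : nat) (j : {ffun 'I_n -> 'I_(2 * N).+1}) : 'rV[int]_n :=
  \row_i ((j i)%:Z - N%:Z).

(* dyadic block  sum_{2^m <= |xi| < 2^(m+1)} e^{i2pi x.xi} \hat f(xi)
   (the cube of radius 2^(m+1) contains all such xi, each exactly once) *)
Definition dyad (n : nat) (f : fn n) (m : nat) : fn n := fun x =>
  \sum_(j : {ffun 'I_n -> 'I_(2 * 2 ^ m.+1).+1} |
         (((4 ^ m)%N%:Z <= normsqZ (boxpt j)) && (normsqZ (boxpt j) < (4 ^ m.+1)%N%:Z))%R)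
     echar (boxpt j) x * fourier f (boxpt j).

(* L^p(T^n) norm, 1 <= p <= oo (for p = oo: supremum; it is only applied to
   L^p spaces with finite p and to trigonometric polynomials) *)
Definition Lpnorm (n : nat) (p : \bar R) (f : fn n) : \bar R :=
  match p with
  | r%:E => ((cubeintE (fun t => ((cabs (f (rowofT t)))%:E `^ r)%E)) `^ r^-1)%E
  | +oo%E => ereal_sup [set (cabs (f x))%:E | x in setT]
  | -oo%E => 0%E
  end.

Definition besov (n : nat) (w : R) (p q : \bar R) (f : fn n) : \bar R :=
  match q with
  | r%:E => ((\sum_(0 <= m <oo)
               (((powR 2 (m%:R * w))%:E * Lpnorm p (dyad f m)) `^ r)%E) `^ r^-1)%E
  | +oo%E => ereal_sup [set ((powR 2 (m%:R * w))%:E * Lpnorm p (dyad f m))%E | m in setT]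
  | -oo%E => 0%E
  end.

Definition holder_norm (n : nat) (s : R) (f : fn n) : \bar R :=
  (ereal_sup [set e | exists (x h : 'rV[R]_n), h != 0%R /\
      e = ((cabs (f (x + h) - f x)) / powR (Num.sqrt (\sum_i (h 0 i) ^+ 2)) s)%:E]
   + ereal_sup [set (cabs (f x))%:E | x in setT])%E.

Definition periodic (n : nat) (f : fn n) :=
  forall x (i : 'I_n), f (x + delta_mx 0 i) = f x.

Definition cmeasurable (n : nat) (f : fn n) :=
  measurable_fun setT (fun t : n.-tuple R => complex.Re (f (rowofT t))) /\
  measurable_fun setT (fun t : n.-tuple R => complex.Im (f (rowofT t))).

Definition Lp_space (n : nat) (p : R) : set (fn n) :=
  [set f | periodic f /\ cmeasurable f /\ (Lpnorm p%:E f < +oo)%E].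

Definition besov_space (n : nat) (w : R) (p q : \bar R) : set (fn n) :=
  [set f | periodic f /\ cmeasurable f /\ (Lpnorm 1%:E f < +oo)%E
           /\ (besov w p q f < +oo)%E].

Definition holder_space (n : nat) (s : R) : set (fn n) :=
  [set f | periodic f /\ (holder_norm s f < +oo)%E].

Definition dpart (n : nat) (i : 'I_n) (g : 'rV[R]_n -> R) : 'rV[R]_n -> R :=
  fun x => 'D_(delta_mx 0 i) g x.

Definition Dseq (n : nat) (s : seq 'I_n) (g : 'rV[R]_n -> R) : 'rV[R]_n -> R :=
  foldr (@dpart n) g s.

Definition smooth (n : nat) (g : 'rV[R]_n -> R) :=
  forall (s : seq 'I_n) x, differentiable (Dseq s g) x.

(* S^m_{rho,delta,0,mu}(T^n x Z^n); a multi-index beta with |beta| <= mu is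
   represented by a sequence of directions of length |beta| *)
Definition symbol_class (n : nat) (m rho delta : R) (mu : nat)
    (a : 'rV[R]_n -> 'rV[int]_n -> R[i]) :=
  (forall xi, periodic (a^~ xi)) /\
  (forall xi, smooth (fun x => complex.Re (a x xi)) /\ smooth (fun x => complex.Im (a x xi))) /\
  (forall s : seq 'I_n, (size s <= mu)%N -> exists C : R, forall x xi,
     cabs ((Dseq s (fun y => complex.Re (a y xi)) x) +i* (Dseq s (fun y => complex.Im (a y xi)) x))%C
       <= C * powR (jbr xi) (m + delta * (size s)%:R)).

Definition Tpart (n : nat) (a : 'rV[R]_n -> 'rV[int]_n -> R[i]) (u : fn n)
    (N : nat) : fn n := fun x =>
  \sum_(j : {ffun 'I_n -> 'I_(2 * N).+1})
     echar (boxpt j) x * a x (boxpt j) * fourier u (boxpt j).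

Definition Top (n : nat) (a : 'rV[R]_n -> 'rV[int]_n -> R[i]) (u : fn n) : fn n :=
  fun x => ((limn (fun N => complex.Re (Tpart a u N x))) +i*
            (limn (fun N => complex.Im (Tpart a u N x))))%C.

Definition clinear_on (n : nat) (E : set (fn n)) (e : fn n -> R[i]) :=
  forall u v (al be : R[i]), E u -> E v ->
    e (fun x => al * u x + be * v x) = al * e u + be * e v.

Definition dual_norm (n : nat) (E : set (fn n)) (NE : fn n -> \bar R)
    (e : fn n -> R[i]) : \bar R :=
  ereal_sup [set (cabs (e u))%:E | u in [set u | E u /\ (NE u <= 1)%E]].

Definition r_nuclear (n : nat) (r : R) (E : set (fn n)) (NE : fn n -> \bar R)
    (F : set (fn n)) (NF : fn n -> \bar R) (T : fn n -> fn n) :=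
  (forall u, E u -> F (T u)) /\
  exists (e : nat -> fn n -> R[i]) (y : nat -> fn n),
    (forall j, clinear_on E (e j) /\ (dual_norm E NE (e j) < +oo)%E) /\
    (forall j, F (y j)) /\
    (\sum_(0 <= j <oo) ((dual_norm E NE (e j) * NF (y j)) `^ r) < +oo)%E /\
    (forall u, E u ->
       (fun N => NF (fun x => T u x - \sum_(j < N) e j u * y j x)) @ \oo --> 0%E).

End Defs.

(* Main.v *)
(* T_a is the sum over xi of the rank one operators u |-> (fourier u xi) y_xi with
   y_xi = e^{i 2 pi x.xi} a(x, xi).  The functionals u |-> fourier u xi are uniformly
   bounded on L^p and on the Hoelder space, since both embed in L^1.  The Fourier
   coefficients of y_xi are those of a(., xi) translated by xi, and they are bounded by
   <xi>^{m + 2 k delta} <eta - xi>^{-2k}; this comes from 2k-fold finite differences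
   of a(., xi) with step 1 / (2 |eta_i - xi_i|) rather than from an integration by parts.
   As w_2 < 2k - n, Peetre's inequality gives ||y_xi|| <= C <xi>^{m + w + 2 k delta} in
   B^{w_2}_{p_2,q_2} for every w slightly larger than w_2, and the r-th powers of these
   norms are summable over Z^n because r (m + w + 2 k delta) < -n. *)
Require Import Defs.
From HB Require Import structures.
From mathcomp Require Import all_boot all_order all_algebra.
From mathcomp Require Import complex.
From mathcomp Require Import all_classical all_reals all_analysis.
From mathcomp Require Import measurable_realfun ring lra zify.
Import Order.TTheory GRing.Theory Num.Theory numFieldNormedType.Exports.
Local Open Scope classical_set_scope.
Local Open Scope ring_scope.
Set Implicit Arguments.
Unset Strict Implicit.
Unset Printing Implicit Defensive.

(** Finite differences suit iterated integrals: each one needs only translation invariance over a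
    period and the mean value theorem on a line. The order 2k is even, so that <eta>^{2k} = (1 +
    |eta|^2)^k compares directly with the largest coordinate of eta, and only pure derivatives in
    one direction enter.

    All the Besov norms are controlled by one quantity, the l^1 norm of the Fourier coefficients
    with weight <eta>^{w_2 + eps}. It bounds the dyadic blocks in sup norm, which settles every p_2
    and q_2 at once; the loss eps is paid from the slack in the strict bounds on w_2 and m.

    The obstacle is that T_a u is a pointwise limit over growing cubes, whereas a nuclear series is
    indexed by natural numbers. Since r <= 1, the weights dominating the rank one terms are
    themselves summable, so both orders of summation converge uniformly in x to the same limit. The
    Fourier coefficients of the remainder are then estimated without exchanging an infinite sum and
    an integral: finitely many terms are split off by linearity, and what is left tends to zero
    uniformly. *)

Section ComplexAbs.
Variable R : realType.
Implicit Types z w : R[i].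

Lemma ReD z w : complex.Re (z + w) = complex.Re z + complex.Re w.
Proof. by case: z w => [a b] [c d]. Qed.

Lemma ImD z w : complex.Im (z + w) = complex.Im z + complex.Im w.
Proof. by case: z w => [a b] [c d]. Qed.

Lemma ReB z w : complex.Re (z - w) = complex.Re z - complex.Re w.
Proof. by case: z w => [a b] [c d]. Qed.

Lemma ImB z w : complex.Im (z - w) = complex.Im z - complex.Im w.
Proof. by case: z w => [a b] [c d]. Qed.

Lemma ReM z w : complex.Re (z * w) = complex.Re z * complex.Re w - complex.Im z * complex.Im w.
Proof. by case: z w => [a b] [c d]. Qed.

Lemma ImM z w : complex.Im (z * w) = complex.Re z * complex.Im w + complex.Im z * complex.Re w.
Proof. by case: z w => [a b] [c d]. Qed.

Lemma Re_sum (I : Type) (s : seq I) (F : I -> R[i]) :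
  complex.Re (\sum_(i <- s) F i) = \sum_(i <- s) complex.Re (F i).
Proof. exact: raddf_sum. Qed.

Lemma Im_sum (I : Type) (s : seq I) (F : I -> R[i]) :
  complex.Im (\sum_(i <- s) F i) = \sum_(i <- s) complex.Im (F i).
Proof. exact: raddf_sum. Qed.

Lemma normc_cabs z : `|z| = (cabs z)%:C%C.
Proof. by rewrite normc_def. Qed.

Lemma cabs_ge0 z : 0 <= cabs z.
Proof. exact: sqrtr_ge0. Qed.

Lemma cabs0 : cabs (0 : R[i]) = 0.
Proof. by apply: complexI; rewrite -normc_cabs normr0. Qed.

Lemma cabsM z w : cabs (z * w) = cabs z * cabs w.
Proof. by apply: complexI; rewrite rmorphM /= -!normc_cabs normrM. Qed.

Lemma cabsN z : cabs (- z) = cabs z.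
Proof. by apply: complexI; rewrite -!normc_cabs normrN. Qed.

Lemma cabsX z k : cabs (z ^+ k) = cabs z ^+ k.
Proof. by apply: complexI; rewrite rmorphXn /= -!normc_cabs normrX. Qed.

Lemma ler_cabsD z w : cabs (z + w) <= cabs z + cabs w.
Proof. by rewrite -lecR rmorphD /= -!normc_cabs ler_normD. Qed.

Lemma ler_cabsB z w : cabs (z - w) <= cabs z + cabs w.
Proof. by rewrite -(cabsN w) ler_cabsD. Qed.

Lemma ler_cabs_sum (I : Type) (s : seq I) (P : pred I) (F : I -> R[i]) :
  cabs (\sum_(i <- s | P i) F i) <= \sum_(i <- s | P i) cabs (F i).
Proof.
elim/big_ind2 : _ => [|x1 x2 y1 y2 h1 h2|//]; first by rewrite cabs0.
by apply: le_trans (ler_cabsD _ _) _; exact: lerD.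
Qed.

Lemma ler_Re_cabs z : `|complex.Re z| <= cabs z.
Proof. by rewrite -sqrtr_sqr ler_sqrt ?addr_ge0 ?sqr_ge0// lerDl sqr_ge0. Qed.

Lemma ler_Im_cabs z : `|complex.Im z| <= cabs z.
Proof. by rewrite -sqrtr_sqr ler_sqrt ?addr_ge0 ?sqr_ge0// lerDr sqr_ge0. Qed.

Lemma ler_cabs_ReIm z : cabs z <= `|complex.Re z| + `|complex.Im z|.
Proof.
rewrite -(@ler_pXn2r _ 2) ?nnegrE ?cabs_ge0 ?addr_ge0//.
rewrite sqr_sqrtr ?addr_ge0 ?sqr_ge0// sqrrD !real_normK ?num_real//.
by rewrite lerD2r lerDl mulrn_wge0// mulr_ge0.
Qed.

Lemma cabs_cexpi (t : R) : cabs (cexpi t) = 1.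
Proof. by rewrite /cabs /= cos2Dsin2 sqrtr1. Qed.

Lemma cexpiD (s t : R) : cexpi (s + t) = cexpi s * cexpi t.
Proof.
rewrite /cexpi cosD sinD; apply/eqP; rewrite eq_complex /= eqxx/=.
by rewrite addrC eqxx.
Qed.

Lemma cexpi_int (z : int) : cexpi (2 * pi * z%:~R : R) = 1.
Proof.
have nat_case (k : nat) : cexpi (2 * pi * k%:R : R) = 1.
  elim: k => [|k IH]; first by rewrite mulr0 /cexpi cos0 sin0.
  rewrite -[k.+1%:R]natr1 mulrDr mulr1 cexpiD IH mul1r.
  by rewrite /cexpi mulr_natl cos2pi sin2pi.
case: z => k; first by rewrite -pmulrn nat_case.
rewrite NegzE mulrNz mulrN -pmulrn.
rewrite -[LHS]mulr1 -[X in _ * X](nat_case k.+1) -cexpiD addNr.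
by rewrite /cexpi cos0 sin0.
Qed.

Lemma cexpi_pi : cexpi (pi : R) = -1.
Proof. by apply/eqP; rewrite eq_complex/= cospi sinpi oppr0 !eqxx. Qed.

Lemma cexpiNpi : cexpi (- pi : R) = -1.
Proof. by apply/eqP; rewrite eq_complex/= cosN sinN cospi sinpi oppr0 !eqxx. Qed.

End ComplexAbs.

(** * Iterated integrals over the unit cube *)

Section CubeIntegral.
Variable R : realType.
Local Notation mu := (@lebesgue_measure R).
Local Notation I01 := (`[0%R, 1%R]%classic : set (measurableTypeR R)).

(** Tonelli's theorem gives measurability for integrals over the whole line, so [G] is first
    extended by zero outside [D]. *)
Lemma measurable_param_integral d (T : measurableType d) (D : set (measurableTypeR R))
    (G : T * measurableTypeR R -> \bar R) :
  measurable D -> measurable_fun setT G -> (forall x, (0 <= G x)%E) ->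
  measurable_fun setT (fun t => \int[mu]_(s in D) G (t, s))%E.
Proof.
move=> mD mG G0.
have mTD : measurable (setT `*` D : set (T * measurableTypeR R)) by exact: measurableX.
have mH : measurable_fun setT (G \_ (setT `*` D)).
  by apply/(measurable_restrictT _ mTD); exact: measurable_funS mG.
have H0 x : (0 <= (G \_ (setT `*` D)) x)%E by apply: erestrict_ge0.
have := measurable_fun_fubini_tonelli_F (m2 := mu) _ mH H0.
apply: eq_measurable_fun => t _; rewrite /fubini_F [RHS]integral_mkcond.
apply: eq_integral => s _; rewrite !patchE; congr (if _ then _ else _).
by rewrite in_setX mem_setT.
Qed.

Lemma measurable_slice k d (U : measurableType d) (F : k.+1.-tuple R -> U) :
  measurable_fun setT F -> forall t : R,
  measurable_fun setT (fun y : k.-tuple R => F [tuple of t :: y]).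
Proof.
move=> mF t; apply: (measurableT_comp mF).
by apply: (@measurable_cons _ _ _ (measurableTypeR R)) => //; exact: measurable_cst.
Qed.

Lemma measurable_uncons k d (U : measurableType d) d' (T : measurableType d')
    (F : T * k.+1.-tuple R -> U) : measurable_fun setT F ->
  measurable_fun setT (fun z : (T * measurableTypeR R) * k.-tuple R =>
     F (z.1.1, [tuple of z.1.2 :: z.2])).
Proof.
move=> mF; apply: (measurableT_comp mF).
apply/measurable_fun_pairP; split => /=.
  exact: (measurableT_comp measurable_fst measurable_fst).
apply: (@measurable_cons _ _ _ (measurableTypeR R)) => //.
exact: (measurableT_comp measurable_snd measurable_fst).
Qed.

Lemma cubeintE_ge0 k (F : k.-tuple R -> \bar R) :
  (forall x, (0 <= F x)%E) -> (0 <= cubeintE F)%E.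
Proof.
by elim: k F => [|k IH] F F0 //=; apply: integral_ge0 => s _; apply: IH.
Qed.

Lemma measurable_cubeintE k d (T : measurableType d) (F : T * k.-tuple R -> \bar R) :
  measurable_fun setT F -> (forall x, (0 <= F x)%E) ->
  measurable_fun setT (fun t => cubeintE (fun y => F (t, y))).
Proof.
elim: k d T F => [|k IH] d T F mF F0 /=.
  by apply: (measurableT_comp mF); exact: measurable_pair2.
apply: (measurable_param_integral (D := I01)
  (G := fun z => cubeintE (fun y => F (z.1, [tuple of z.2 :: y])))) => //.
- by apply: (IH _ _ (fun z => F (z.1.1, [tuple of z.1.2 :: z.2]))) => //; exact: measurable_uncons.
- by move=> x; exact: cubeintE_ge0.
Qed.

(** Integrability is not assumed, so the inner integral is treated as the difference of the
    integrals of the positive and negative parts, each measurable by Tonelli; [fine] is measurable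
    whatever values it meets. *)
Lemma measurable_cubeint k d (T : measurableType d) (F : T * k.-tuple R -> R) :
  measurable_fun setT F ->
  measurable_fun setT (fun t => cubeint (fun y => F (t, y))).
Proof.
elim: k d T F => [|k IH] d T F mF /=.
  by apply: (measurableT_comp mF); exact: measurable_pair2.
pose G := fun z : T * measurableTypeR R => cubeint (fun y => F (z.1, [tuple of z.2 :: y])).
have mG : measurable_fun setT (EFin \o G).
  apply/measurable_EFinP.
  by apply: (IH _ _ (fun z => F (z.1.1, [tuple of z.1.2 :: z.2]))); exact: measurable_uncons.
rewrite /Rintegral; apply: measurableT_comp => //.
apply: (eq_measurable_fun (fun t => \int[mu]_(s in I01) ((EFin \o G)^\+ (t, s)) -
   \int[mu]_(s in I01) ((EFin \o G)^\- (t, s)))%E).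
  move=> t _; rewrite [RHS]integralE.
  under [X in _ = (X - _)%E]eq_integral do rewrite (funepos_comp (EFin \o G) (fun s => (t, s)))/=.
  by under [X in _ = (_ - X)%E]eq_integral do rewrite (funeneg_comp (EFin \o G) (fun s => (t, s)))/=.
apply: emeasurable_funB.
- by apply: measurable_param_integral => //; exact: measurable_funepos.
- by apply: measurable_param_integral => //; exact: measurable_funeneg.
Qed.

Lemma measurable_cubeintE_slice k (F : k.+1.-tuple R -> \bar R) (D : set (measurableTypeR R)) :
  measurable D -> measurable_fun setT F -> (forall x, (0 <= F x)%E) ->
  measurable_fun D (fun t => cubeintE (fun y => F [tuple of t :: y])).
Proof.
move=> mD mF F0; apply: (@measurable_funS _ _ _ _ setT) => //.
apply: (measurable_cubeintE (F := fun z : measurableTypeR R * k.-tuple R => F [tuple of z.1 :: z.2])) => //.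
apply: (measurableT_comp mF).
by apply: (@measurable_cons _ _ _ (measurableTypeR R)).
Qed.

Lemma measurable_cubeint_slice k (F : k.+1.-tuple R -> R) (D : set (measurableTypeR R)) :
  measurable D -> measurable_fun setT F ->
  measurable_fun D (fun t => cubeint (fun y => F [tuple of t :: y])).
Proof.
move=> mD mF; apply: (@measurable_funS _ _ _ _ setT) => //.
apply: (measurable_cubeint (F := fun z : measurableTypeR R * k.-tuple R => F [tuple of z.1 :: z.2])).
apply: (measurableT_comp mF).
by apply: (@measurable_cons _ _ _ (measurableTypeR R)).
Qed.

Lemma le_cubeintE k (F G : k.-tuple R -> \bar R) :
  measurable_fun setT F -> measurable_fun setT G ->
  (forall x, (0 <= F x)%E) -> (forall x, (F x <= G x)%E) ->
  (cubeintE F <= cubeintE G)%E.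
Proof.
elim: k F G => [|k IH] F G mF mG F0 FG //=.
have G0 x : (0 <= G x)%E by apply: le_trans (FG x).
apply: ge0_le_integral => //.
- by move=> t _; exact: cubeintE_ge0.
- exact: measurable_cubeintE_slice.
- exact: measurable_cubeintE_slice.
- by move=> t _; apply: IH => //; exact: measurable_slice.
Qed.

Lemma cubeintE_cst k (c : \bar R) : cubeintE (fun _ : k.-tuple R => c) = c.
Proof.
elim: k => [|k IH] //=; under eq_integral do rewrite IH.
by rewrite integral_cst//= lebesgue_measure_itv/= lte_fin ltr01 oppr0 adde0 mule1.
Qed.

Lemma cubeintED k (F G : k.-tuple R -> \bar R) :
  measurable_fun setT F -> measurable_fun setT G ->
  (forall x, (0 <= F x)%E) -> (forall x, (0 <= G x)%E) ->
  (cubeintE (F \+ G) = cubeintE F + cubeintE G)%E.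
Proof.
elim: k F G => [|k IH] F G mF mG F0 G0 //=.
rewrite -ge0_integralD//; first last.
- exact: measurable_cubeintE_slice.
- by move=> t _; exact: cubeintE_ge0.
- exact: measurable_cubeintE_slice.
- by move=> t _; exact: cubeintE_ge0.
by apply: eq_integral => t _; apply: IH => //; exact: measurable_slice.
Qed.

Lemma cubeintEZl k (c : R) (F : k.-tuple R -> \bar R) : 0 <= c ->
  measurable_fun setT F -> (forall x, (0 <= F x)%E) ->
  (cubeintE (fun x => c%:E * F x) = c%:E * cubeintE F)%E.
Proof.
move=> c0; elim: k F => [|k IH] F mF F0 //=.
rewrite -ge0_integralZl//; first last.
- by move=> t _; exact: cubeintE_ge0.
- exact: measurable_cubeintE_slice.
by apply: eq_integral => t _; apply: IH => //; exact: measurable_slice.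
Qed.

Lemma le_abs_fine (x : \bar R) : (`|fine x|%:E <= `|x|)%E.
Proof. by case: x => [x| |] //=; rewrite normr0 leey. Qed.

(* The infinite values of the inner integrals are harmless: [fine] sends them to 0. *)
Lemma le_norm_cubeint k (F : k.-tuple R -> R) : measurable_fun setT F ->
  (`|cubeint F|%:E <= cubeintE (fun x => `|F x|%:E))%E.
Proof.
elim: k F => [|k IH] F mF //=.
have mnF : measurable_fun setT (fun x => `|F x|%:E).
  by apply/measurable_EFinP; exact: measurableT_comp.
have mf : measurable_fun I01 (fun t => (cubeint (fun y => F [tuple of t :: y]))%:E).
  by apply/measurable_EFinP; exact: measurable_cubeint_slice.
rewrite /Rintegral; apply: (le_trans (le_abs_fine _)).
apply: (le_trans (le_abse_integral _ _ mf)) => //.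
apply: ge0_le_integral => //.
- exact: measurableT_comp.
- exact: (measurable_cubeintE_slice (F := fun x => `|F x|%:E)).
- by move=> t _; apply: IH; exact: measurable_slice.
Qed.

Definition cubeintegrable k (F : k.-tuple R -> R) :=
  measurable_fun setT F /\ (cubeintE (fun x => `|F x|%:E) < +oo)%E.

(** The integral of [|F|] over the remaining variables has a finite integral in [t], hence is finite
    for almost every [t]. *)
Lemma cubeintegrable_slice k (F : k.+1.-tuple R -> R) : cubeintegrable F ->
  {ae mu, forall t, I01 t -> cubeintegrable (fun y => F [tuple of t :: y])}.
Proof.
move=> [mF iF].
have mnF : measurable_fun setT (fun x => `|F x|%:E).
  by apply/measurable_EFinP; exact: measurableT_comp.
pose psi := fun t : measurableTypeR R => cubeintE (fun y => `|F [tuple of t :: y]|%:E).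
have psi0 t : (0 <= psi t)%E by exact: cubeintE_ge0.
have ipsi : mu.-integrable I01 psi.
  apply/integrableP; split.
    exact: (measurable_cubeintE_slice (F := fun x => `|F x|%:E)).
  by under eq_integral do rewrite gee0_abs//.
have mI : measurable I01 by [].
have [A [mA A0 sA]] := integrable_ae mI ipsi; exists A; split => //.
apply: subset_trans sA; apply: subsetC => t /= ft It; split.
  exact: measurable_slice.
by have := ft It; rewrite ge0_fin_numE.
Qed.

Lemma integrable_cubeint_slice k (F : k.+1.-tuple R -> R) : cubeintegrable F ->
  mu.-integrable I01 (fun t => (cubeint (fun y => F [tuple of t :: y]))%:E).
Proof.
move=> [mF iF].
have mnF : measurable_fun setT (fun x => `|F x|%:E).
  by apply/measurable_EFinP; exact: measurableT_comp.
have mf : measurable_fun I01 (fun t => (cubeint (fun y => F [tuple of t :: y]))%:E).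
  by apply/measurable_EFinP; exact: measurable_cubeint_slice.
apply/integrableP; split => //; apply: le_lt_trans iF.
apply: ge0_le_integral => //.
- exact: measurableT_comp.
- exact: (measurable_cubeintE_slice (F := fun x => `|F x|%:E)).
- by move=> t _; apply: le_norm_cubeint; exact: measurable_slice.
Qed.

Lemma cubeintegrableD k (a b : R) (F G : k.-tuple R -> R) :
  cubeintegrable F -> cubeintegrable G ->
  cubeintegrable (fun x => a * F x + b * G x).
Proof.
move=> [mF iF] [mG iG]; split.
  by apply: measurable_funD; apply: measurable_funM => //; exact: measurable_cst.
have mnF : measurable_fun setT (fun x => `|F x|%:E).
  by apply/measurable_EFinP; exact: measurableT_comp.
have mnG : measurable_fun setT (fun x => `|G x|%:E).
  by apply/measurable_EFinP; exact: measurableT_comp.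
apply: (@le_lt_trans _ _ (cubeintE ((fun x => `|a|%:E * `|F x|%:E) \+ (fun x => `|b|%:E * `|G x|%:E)))%E).
  apply: le_cubeintE => //.
  - apply/measurable_EFinP; apply: measurableT_comp => //.
    by apply: measurable_funD; apply: measurable_funM => //; exact: measurable_cst.
  - by apply: emeasurable_funD; apply: emeasurable_funM => //; exact: measurable_cst.
  - by move=> x /=; rewrite -!EFinM -EFinD lee_fin -!normrM; exact: ler_normD.
rewrite cubeintED//; first last.
- by apply: emeasurable_funM => //; exact: measurable_cst.
- by apply: emeasurable_funM => //; exact: measurable_cst.
rewrite !cubeintEZl//; apply: lte_add_pinfty.
- by rewrite lte_mul_pinfty.
- by rewrite lte_mul_pinfty.
Qed.

Lemma cubeintD k (a b : R) (F G : k.-tuple R -> R) :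
  cubeintegrable F -> cubeintegrable G ->
  cubeint (fun x => a * F x + b * G x) = a * cubeint F + b * cubeint G.
Proof.
elim: k F G => [|k IH] F G iF iG //=.
have iFs := integrable_cubeint_slice iF; have iGs := integrable_cubeint_slice iG.
have mI : measurable I01 by [].
have aiF := integrableZl mI a iFs.
have biG := integrableZl mI b iGs.
rewrite -!RintegralZl// -RintegralD//.
(* Additivity of the inner integrals is available only where both slices are integrable, that is,
   off the union of two null sets. *)
congr fine; apply: ae_eq_integral => //.
- apply/measurable_EFinP.
  apply: (@measurable_cubeint_slice _ (fun x => a * F x + b * G x)) => //.
  by case: iF iG => mF _ [mG _]; apply: measurable_funD; apply: measurable_funM => //; exact: measurable_cst.
- by apply: measurable_int; exact: (integrableD _ aiF biG).
- have [A [mA A0 sA]] := cubeintegrable_slice iF.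
  have [B [mB B0 sB]] := cubeintegrable_slice iG.
  exists (A `|` B); split; [exact: measurableU | by rewrite -A0; exact: measureU0 |].
  rewrite -[A `|` B]setCK setCU; apply: subsetC => t [nA nB] It /=.
  congr EFin; apply: IH.
  + by apply: contrapT => h; apply: nA; apply: sA => /(_ It).
  + by apply: contrapT => h; apply: nB; apply: sB => /(_ It).
Qed.

Lemma measurable_addr (h : R) :
  @measurable_fun _ _ (measurableTypeR R) (measurableTypeR R) setT (fun x => x + h).
Proof. by apply: measurable_funD => //; exact: measurable_cst. Qed.

(** A measure giving every half-open interval its length is Lebesgue measure, and the pushforward by
    a translation does so. *)
Lemma lebesgue_measure_addr (h : R) (A : set (measurableTypeR R)) : measurable A ->
  @pushforward _ _ (measurableTypeR R) (measurableTypeR R) R mu (fun x => x + h) A = mu A.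
Proof.
move=> mA.
pose f : measurableTypeR R -> measurableTypeR R := fun x => x + h.
pose mu' : {measure set (measurableTypeR R) -> \bar R} := @pushforward _ _ _ _ R mu f.
apply/esym; apply: (lebesgue_measure_unique (mu := mu' (measurable_addr h))) => // _ [[a b]] _ <-.
rewrite /mu' /= /pushforward/= (_ : f @^-1` _ = `]a - h, b - h]%classic); last first.
  by apply/seteqP; split => x /=; rewrite !in_itv/= ltrBlDr lerBrDr.
rewrite !lebesgue_measure_itv/= !lte_fin ltrD2r; case: ifP => // _.
by rewrite -!EFinD; congr EFin; ring.
Qed.

Lemma Rintegral_addr (a b h : R) (phi : R -> R) :
  measurable_fun (setT : set (measurableTypeR R)) phi ->
  mu.-integrable `[a + h, b + h]%classic (EFin \o phi) ->
  Rintegral mu `[a, b] (fun t => phi (t + h)) = Rintegral mu `[a + h, b + h] phi.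
Proof.
move=> mphi iphi; congr fine.
have mD : measurable (`[a + h, b + h]%classic : set (measurableTypeR R)) by [].
pose f : measurableTypeR R -> measurableTypeR R := fun x => x + h.
have fD : f @^-1` `[a + h, b + h] = `[a, b]%classic.
  by apply/seteqP; split => x /=; rewrite !in_itv/= !lerD2r.
pose mu' : {measure set (measurableTypeR R) -> \bar R} := @pushforward _ _ _ _ R mu f.
transitivity (\int[@pushforward _ _ (measurableTypeR R) (measurableTypeR R) R mu f]_(x in `[(a + h)%R, (b + h)%R]) (phi x)%:E)%E; last first.
  by apply: (eq_measure_integral mu (m1 := mu' (measurable_addr h))) => A mA _; exact: lebesgue_measure_addr.
rewrite (integral_pushforward (measurable_addr h) (mu := mu) (f := EFin \o phi)) //.
- by rewrite fD.
- by apply/measurable_EFinP.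
- rewrite fD.
  have mDab : measurable (`[a, b]%classic : set (measurableTypeR R)) by [].
  apply/integrableP; split.
    apply/measurable_EFinP; apply: (@measurable_funS _ _ _ _ setT) => //.
    exact: (measurableT_comp mphi (measurable_addr h)).
  case/integrableP: iphi => _; rewrite -fD.
  rewrite -(ge0_integral_pushforward (measurable_addr h) mu (f := fun x => `|(EFin \o phi) x|%E)) //.
    move=> H; apply: le_lt_trans H; rewrite le_eqVlt; apply/orP; left; apply/eqP.
    by apply: (eq_measure_integral mu (m1 := mu' (measurable_addr h))) => A mA _; exact: lebesgue_measure_addr.
  apply/measurable_EFinP; apply: (@measurable_funS _ _ _ _ setT) => //.
  exact: measurableT_comp.
Qed.

Lemma integrable_bounded_itv (a b M : R) (phi : R -> R) :
  measurable_fun (setT : set (measurableTypeR R)) phi -> (forall t, `|phi t| <= M) ->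
  mu.-integrable `[a, b]%classic (EFin \o phi).
Proof.
move=> mphi phiM.
have mD : measurable (`[a, b]%classic : set (measurableTypeR R)) by [].
apply: measurable_bounded_integrable => //.
- by rewrite [X in (X < _)%E]lebesgue_measure_itv/=; case: ifP => // _; rewrite -EFinB ltry.
- exact: (@measurable_funS _ _ _ _ setT).
- exists M; split; first exact: num_real.
  by move=> x xM t _; exact: le_trans (phiM t) (ltW xM).
Qed.

(** Cutting [[h, 1 + h]] at 1 and [[0, 1]] at [h] leaves a common piece between [h] and 1; the other
    pieces, over [[1, 1 + h]] and [[0, h]], agree by periodicity. The condition [0 <= h <= 1] places
    both cuts inside. *)
Lemma Rintegral_periodic_addr (h M : R) (phi : R -> R) :
  measurable_fun (setT : set (measurableTypeR R)) phi ->
  (forall t, `|phi t| <= M) -> (forall t, phi (t + 1) = phi t) -> 0 <= h <= 1 ->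
  Rintegral mu I01 (fun t => phi (t + h)) = Rintegral mu I01 phi.
Proof.
move=> mphi phiM phi1 /andP[h0 h1].
have iphi a b := @integrable_bounded_itv a b M phi mphi phiM.
rewrite Rintegral_addr// add0r.
have := @Rintegral_itvB _ phi (BLeft h) (BRight (1 + h)) 1 (iphi _ _).
rewrite !bnd_simp lerDl h0 h1 => /(_ isT isT).
have := @Rintegral_itvB _ phi (BLeft 0) (BRight 1) h (iphi _ _).
rewrite !bnd_simp h0 h1 => /(_ isT isT).
rewrite !Rintegral_itv_obnd_cbnd //; first last.
- by apply: integrableS (iphi _ _) => //; exact: subset_itv_oc_cc.
- by apply: integrableS (iphi _ _) => //; exact: subset_itv_oc_cc.
have -> : Rintegral mu `[1, 1 + h] phi = Rintegral mu `[0, h] phi.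
  have := @Rintegral_addr 0 h 1 phi mphi (iphi _ _).
  rewrite add0r [h + 1]addrC => <-.
    by apply: eq_Rintegral => t _; rewrite phi1.
by move=> /eqP; rewrite subr_eq => /eqP -> /eqP; rewrite subr_eq addrC => /eqP ->; rewrite addrC.
Qed.

Definition tshift k (i : 'I_k) (h : R) (t : k.-tuple R) : k.-tuple R :=
  [tuple tnth t j + (if j == i then h else 0) | j < k].

Lemma tshift_cons0 k h (t : R) (y : k.-tuple R) :
  tshift ord0 h [tuple of t :: y] = [tuple of (t + h) :: y].
Proof.
apply: eq_from_tnth => j; rewrite tnth_mktuple.
have [j' ->|->] := unliftP ord0 j; last first.
  by rewrite eqxx !tnth0.
by rewrite !tnthS addr0.
Qed.

Lemma tshift_cons k (i : 'I_k) h (t : R) (y : k.-tuple R) :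
  tshift (lift ord0 i) h [tuple of t :: y] = [tuple of t :: tshift i h y].
Proof.
apply: eq_from_tnth => j; rewrite tnth_mktuple.
have [j' ->|->] := unliftP ord0 j; last first.
  by rewrite !tnth0 /= addr0.
by rewrite !tnthS tnth_mktuple (inj_eq lift_inj).
Qed.

Lemma cubeintegrable_bounded k (F : k.-tuple R -> R) M :
  measurable_fun setT F -> (forall t, `|F t| <= M) ->
  (cubeintE (fun x => `|F x|%:E) <= M%:E)%E.
Proof.
move=> mF FM; rewrite -[leRHS](cubeintE_cst k); apply: le_cubeintE => //.
- by apply/measurable_EFinP; exact: measurableT_comp.
Qed.

Lemma cubeint_bounded k (F : k.-tuple R -> R) M :
  measurable_fun setT F -> (forall t, `|F t| <= M) -> `|cubeint F| <= M.
Proof.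
move=> mF FM; rewrite -lee_fin; apply: le_trans (le_norm_cubeint mF) _.
exact: cubeintegrable_bounded.
Qed.

(** Induction on the dimension: a shift of the outermost variable is the one-dimensional case
    applied to the inner integral, and any other shift passes inside. A uniform bound is assumed
    instead of integrability because every slice inherits it, not just almost every one. *)
Lemma cubeint_tshift k (i : 'I_k) (h M : R) (F : k.-tuple R -> R) :
  measurable_fun setT F -> (forall t, `|F t| <= M) ->
  (forall t, F (tshift i 1 t) = F t) -> 0 <= h <= 1 ->
  cubeint (fun t => F (tshift i h t)) = cubeint F.
Proof.
elim: k i F => [[]//|k IH] i F mF FM F1 h01 /=.
have [j ij|i0] := unliftP ord0 i; subst i; last first.
  under eq_Rintegral do under eq_fun do rewrite tshift_cons0.
  apply: (@Rintegral_periodic_addr h M (fun t => cubeint (fun y => F [tuple of t :: y]))) => //.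
  - exact: measurable_cubeint_slice.
  - by move=> t; apply: cubeint_bounded => //; exact: measurable_slice.
  - by move=> t; congr cubeint; apply/funext => y; rewrite -tshift_cons0 F1.
apply: eq_Rintegral => t _; under eq_fun do rewrite tshift_cons.
apply: (IH j (fun y => F [tuple of t :: y])) => //.
- exact: measurable_slice.
- by move=> y; rewrite -tshift_cons F1.
Qed.

End CubeIntegral.

(** * Measurability of continuous functions on R^n *)

Section ContinuousMeasurable.
Variable R : realType.

(** Measurability refers to the product sigma-algebra of tuples, continuity to row vectors. The
    bridge is a pointwise limit of step functions: rounding down to the grid of mesh [1 / N.+1]
    takes countably many values, each on a half-open cube. *)
Lemma continuous_rowofT_measurable n (g : 'rV[R]_n -> R) : continuous g ->
  measurable_fun setT (fun t : n.-tuple R => g (rowofT t)).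
Proof.
move=> cg.
pose G N (z : n.-tuple int) := g (\row_i ((tnth z i)%:~R / N.+1%:R)).
pose fl N (t : n.-tuple R) : n.-tuple int := [tuple Num.floor (N.+1%:R * tnth t i) | i < n].
apply: (@measurable_fun_cvg _ _ _ setT (fun N t => G N (fl N t))).
  move=> N _ Y mY; rewrite setTI.
  rewrite (_ : _ @^-1` Y = \bigcup_z ([set t | fl N t = z] `&` [set t | Y (G N z)])); last first.
    apply/seteqP; split => [t Yt|t [z _ [/= <-]]//].
    by exists (fl N t).
  apply: countable_bigcupT_measurable => [|z]; first exact: countableP.
  have [YG|nYG] := pselect (Y (G N z)); last first.
    rewrite (_ : _ `&` _ = set0)//; last by apply/seteqP; split => t // -[].
  rewrite (_ : [set t | Y (G N z)] = setT) ?setIT; last by apply/seteqP; split.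
  rewrite (_ : [set t | fl N t = z] = \bigcap_(i in [set: 'I_n])
     ((fun t => tnth t i) @^-1` `[(tnth z i)%:~R / N.+1%:R, ((tnth z i) + 1)%:~R / N.+1%:R[)); last first.
    apply/seteqP; split => t /=.
      move=> <- i _ /=; rewrite in_itv/= tnth_mktuple.
      rewrite ler_pdivrMr// ltr_pdivlMr// [_ * N.+1%:R]mulrC.
      exact: floor_itv.
    move=> tz; apply: eq_from_tnth => i; rewrite tnth_mktuple.
    apply: floor_def; have := tz i I; rewrite /= in_itv/=.
    by rewrite ler_pdivrMr// ltr_pdivlMr// [_ * N.+1%:R]mulrC.
  apply: fin_bigcap_measurable => [|i _]; first exact: finite_finset.
  rewrite -[X in measurable X]setTI; apply: (@measurable_tnth _ (measurableTypeR R)) => //.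
move=> t _; apply/cvgrPdist_lt => e e0.
have /cvgrPdist_lt/(_ e e0) := cg (rowofT t).
move=> /nbhs_ballP[d /= d0 hd].
(* Closeness of row vectors is coordinatewise, so rounding moves the point by at most [1 / N.+1],
   the harmonic sequence. *)
have /cvgrPdist_lt/(_ d d0) := @cvg_harmonic R.
apply: filterS => N /= hN; apply: hd; split => // i j.
rewrite !mxE tnth_mktuple /ball/= /ball_.
move: hN; rewrite sub0r normrN /harmonic => hN; apply: le_lt_trans hN.
have := floor_itv (N.+1%:R * tnth t j); set z := Num.floor _ => /andP[z1 z2].
have N0 : N.+1%:R != 0 :> R by [].
rewrite (_ : tnth t j - _ = N.+1%:R^-1 * (N.+1%:R * tnth t j - z%:~R)); last by field.
rewrite normrM ler_piMr// ger0_norm ?subr_ge0//; move: z2; rewrite intrD => z2.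
by rewrite lerBlDl ltW.
Qed.
End ContinuousMeasurable.

(** * Finite differences along a coordinate direction *)

Section Line.
Variable R : realType.
Variable n : nat.
Implicit Types (x v : 'rV[R]_n).

Lemma is_derive_line (G : 'rV[R]_n -> R) (dG : R) x v (t : R) :
  is_derive (x + t *: v) v G dG ->
  is_derive t 1 (fun s : R => G (x + s *: v)) dG.
Proof.
move=> [derG valG].
have E : (fun h : R => h^-1 *: (((fun s : R => G (x + s *: v)) \o shift t) (h *: 1) - G (x + t *: v)))
   = (fun h => h^-1 *: ((G \o shift (x + t *: v)) (h *: v) - G (x + t *: v))).
  apply/funext => h /=; congr (_ *: (G _ - _)).
  by rewrite -[h%:A]/(h * 1) mulr1 scalerDl addrCA.
split; first by rewrite /derivable E.
by rewrite -valG /derive E.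
Qed.

Lemma line_mean_value (G G' : 'rV[R]_n -> R) v (B h : R) : 0 <= h ->
  (forall x, is_derive x v G (G' x)) -> (forall x, `|G' x| <= B) ->
  forall x, `|G (x + h *: v) - G x| <= h * B.
Proof.
move=> h0 dG GB x.
pose phi s := G (x + s *: v).
have dphi (s : R) : is_derive s 1 phi (G' (x + s *: v)) by exact: is_derive_line.
have cphi : {within `[0, h], continuous phi}.
  apply: continuous_subspaceT => s.
  by apply: differentiable_continuous; apply/derivable1_diffP; case: (dphi s).
have [c _] := MVT_segment h0 (fun s _ => dphi s) cphi.
rewrite /phi scale0r addr0 subr0 => ->.
by rewrite normrM (ger0_norm h0) mulrC ler_wpM2l.
Qed.

(** The codomain is any [zmodType], so that complex functions and their real and imaginary parts
    share one definition. *)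
Definition sdiff (V : zmodType) v (h : R) (G : 'rV[R]_n -> V) : 'rV[R]_n -> V :=
  fun x => G (x + h *: v) - G x.

Lemma is_derive_sdiff (G G' : 'rV[R]_n -> R) v w h :
  (forall x, is_derive x w G (G' x)) ->
  forall x, is_derive x w (sdiff v h G) (sdiff v h G' x).
Proof.
move=> dG x; apply: is_deriveB => //.
have [dGh vGh] := dG (x + h *: v).
have E : (fun k : R => k^-1 *: (((fun s => G (s + h *: v)) \o shift x) (k *: w) - G (x + h *: v)))
   = (fun k => k^-1 *: ((G \o shift (x + h *: v)) (k *: w) - G (x + h *: v))).
  by apply/funext => k /=; rewrite addrA.
split; first by rewrite /derivable E.
by rewrite -vGh /derive E.
Qed.

Lemma is_derive_iter_sdiff (G G' : 'rV[R]_n -> R) v w h k :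
  (forall x, is_derive x w G (G' x)) ->
  forall x, is_derive x w (iter k (sdiff v h) G) (iter k (sdiff v h) G' x).
Proof. by move=> dG; elim: k => [//|k IH] x /=; exact: is_derive_sdiff. Qed.

(** [Dseq] is a right fold, so the innermost derivative is the last entry of the list. *)
Lemma smooth_dpart (g : 'rV[R]_n -> R) i : smooth g -> smooth (dpart i g).
Proof. by move=> sg s x; have := sg (rcons s i) x; rewrite /Dseq foldr_rcons. Qed.

(** The mean value inequality trades the outermost difference for a factor [h] and a derivative,
    which commutes with the remaining differences and lands on [g]; induction then applies to
    [dpart i g]. *)
Lemma iter_sdiff_bound (g : 'rV[R]_n -> R) (i : 'I_n) (h B : R) k : 0 <= h ->
  smooth g -> (forall x, `|Dseq (nseq k i) g x| <= B) ->
  forall x, `|iter k (sdiff (delta_mx 0 i) h) g x| <= h ^+ k * B.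
Proof.
move=> h0; elim: k g => [|k IH] g sg gB x; first by rewrite mul1r; exact: gB.
rewrite iterS exprS -mulrA.
apply: (line_mean_value (G' := iter k (sdiff (delta_mx 0 i) h) (dpart i g))) => //.
  apply: is_derive_iter_sdiff => y; split; last by [].
  by apply: diff_derivable; exact: (sg [::]).
apply: IH; first exact: smooth_dpart.
move=> y; have := gB y; rewrite (_ : nseq k.+1 i = rcons (nseq k i) i).
  by rewrite /Dseq foldr_rcons.
by elim: (k) => //= m ->.
Qed.

Lemma smooth_continuous (g : 'rV[R]_n -> R) : smooth g -> continuous g.
Proof. by move=> sg x; apply: differentiable_continuous; exact: (sg [::] x). Qed.

End Line.

(** * Fourier coefficients *)

Section Fourier.
Variable R : realType.
Variable n : nat.
Implicit Types (f g : fn R n) (xi : 'rV[int]_n).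

Definition torus_integrable f :=
  cmeasurable f /\ (cubeintE (fun t => (cabs (f (rowofT t)))%:E) < +oo)%E.

Lemma cmeasurableD f g : cmeasurable f -> cmeasurable g -> cmeasurable (fun x => f x + g x).
Proof.
move=> [f1 f2] [g1 g2]; split.
  apply: (eq_measurable_fun (fun t => complex.Re (f (rowofT t)) + complex.Re (g (rowofT t)))).
    by move=> t _ /=; rewrite raddfD.
  exact: measurable_funD.
apply: (eq_measurable_fun (fun t => complex.Im (f (rowofT t)) + complex.Im (g (rowofT t)))).
  by move=> t _ /=; rewrite raddfD.
exact: measurable_funD.
Qed.

Lemma cmeasurableM f g : cmeasurable f -> cmeasurable g -> cmeasurable (fun x => f x * g x).
Proof.
move=> [f1 f2] [g1 g2]; split.
  apply: (eq_measurable_fun (fun t => complex.Re (f (rowofT t)) * complex.Re (g (rowofT t))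
     - complex.Im (f (rowofT t)) * complex.Im (g (rowofT t)))).
    by move=> t _ /=; rewrite ReM.
  by apply: measurable_funB; exact: measurable_funM.
apply: (eq_measurable_fun (fun t => complex.Re (f (rowofT t)) * complex.Im (g (rowofT t))
     + complex.Im (f (rowofT t)) * complex.Re (g (rowofT t)))).
  by move=> t _ /=; rewrite ImM.
by apply: measurable_funD; exact: measurable_funM.
Qed.

Lemma cmeasurable_cst (c : R[i]) : cmeasurable (fun _ : 'rV[R]_n => c).
Proof. by split; exact: measurable_cst. Qed.

Lemma cmeasurable_sum (I : Type) (s : seq I) (F : I -> fn R n) :
  (forall i, cmeasurable (F i)) -> cmeasurable (fun x => \sum_(i <- s) F i x).
Proof.
move=> mF; elim: s => [|i s IH].
  by under eq_fun do rewrite big_nil; exact: cmeasurable_cst.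
by under eq_fun do rewrite big_cons; exact: cmeasurableD.
Qed.

Lemma measurable_cabs f : cmeasurable f ->
  measurable_fun setT (fun t : n.-tuple R => cabs (f (rowofT t))).
Proof.
move=> [f1 f2]; rewrite /cabs; apply: measurableT_comp.
  by apply: continuous_measurable_fun; exact: sqrt_continuous.
by apply: measurable_funD; apply: measurable_funX.
Qed.

Lemma measurable_dotZ xi : measurable_fun setT (fun t : n.-tuple R => dotZ (rowofT t) xi).
Proof.
apply: (eq_measurable_fun (fun t : n.-tuple R => \sum_(i < n) tnth t i * (xi 0 i)%:~R)).
  by move=> t _; apply: eq_bigr => i _; rewrite mxE.
apply: measurable_sum => i; apply: measurable_funM; last exact: measurable_cst.
exact: (@measurable_tnth _ (measurableTypeR R)).
Qed.

Lemma cmeasurable_cexpi (c : R) xi : cmeasurable (fun x : 'rV[R]_n => cexpi (c * dotZ x xi)).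
Proof.
have mc : measurable_fun setT (fun t : n.-tuple R => c * dotZ (rowofT t) xi).
  by apply: measurable_funM; [exact: measurable_cst|exact: measurable_dotZ].
split => /=.
  apply: (measurableT_comp _ mc); apply: continuous_measurable_fun; exact: continuous_cos.
apply: (measurableT_comp _ mc); apply: continuous_measurable_fun; exact: continuous_sin.
Qed.

Lemma cmeasurable_echar xi : cmeasurable (echar (R := R) xi).
Proof. exact: cmeasurable_cexpi. Qed.

Definition fker xi (x : 'rV[R]_n) : R[i] := cexpi (- (2 * pi * dotZ x xi)).

Lemma cmeasurable_fker xi : cmeasurable (fker xi).
Proof.
rewrite /fker; under eq_fun do rewrite -mulNr; exact: cmeasurable_cexpi.
Qed.

Lemma torus_integrable_Re f : torus_integrable f ->
  cubeintegrable (fun t => complex.Re (f (rowofT t))).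
Proof.
move=> [mf fi]; split; first by case: mf.
apply: le_lt_trans fi; apply: le_cubeintE => //.
- by apply/measurable_EFinP; apply: measurableT_comp => //; case: mf.
- by apply/measurable_EFinP; exact: measurable_cabs.
- by move=> x; rewrite lee_fin ler_Re_cabs.
Qed.

Lemma torus_integrable_Im f : torus_integrable f ->
  cubeintegrable (fun t => complex.Im (f (rowofT t))).
Proof.
move=> [mf fi]; split; first by case: mf.
apply: le_lt_trans fi; apply: le_cubeintE => //.
- by apply/measurable_EFinP; apply: measurableT_comp => //; case: mf.
- by apply/measurable_EFinP; exact: measurable_cabs.
- by move=> x; rewrite lee_fin ler_Im_cabs.
Qed.

Lemma Tint_linear (a b : R[i]) f g : torus_integrable f -> torus_integrable g ->
  Tint (fun x => a * f x + b * g x) = a * Tint f + b * Tint g.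
Proof.
move=> hf hg.
have [f1 f2] := (torus_integrable_Re hf, torus_integrable_Im hf).
have [g1 g2] := (torus_integrable_Re hg, torus_integrable_Im hg).
(* The coefficients 1 give both levels of the sum the shape required by [cubeintD]. *)
have H (p q r s : R) : cubeint (fun t =>
    1 * (p * complex.Re (f (rowofT t)) + q * complex.Im (f (rowofT t))) +
    1 * (r * complex.Re (g (rowofT t)) + s * complex.Im (g (rowofT t)))) =
    1 * (p * cubeint (fun t => complex.Re (f (rowofT t))) + q * cubeint (fun t => complex.Im (f (rowofT t)))) +
    1 * (r * cubeint (fun t => complex.Re (g (rowofT t))) + s * cubeint (fun t => complex.Im (g (rowofT t)))).
  by rewrite cubeintD ?cubeintD//; exact: cubeintegrableD.
apply/eqP; rewrite eq_complex ReD ImD !ReM !ImM; apply/andP; split; apply/eqP => /=.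
  transitivity (cubeint (fun t =>
    1 * (complex.Re a * complex.Re (f (rowofT t)) + (- complex.Im a) * complex.Im (f (rowofT t))) +
    1 * (complex.Re b * complex.Re (g (rowofT t)) + (- complex.Im b) * complex.Im (g (rowofT t))))).
    by congr cubeint; apply/funext => t; rewrite ReD !ReM !mul1r !mulNr.
  by rewrite H !mul1r !mulNr.
transitivity (cubeint (fun t =>
    1 * (complex.Im a * complex.Re (f (rowofT t)) + complex.Re a * complex.Im (f (rowofT t))) +
    1 * (complex.Im b * complex.Re (g (rowofT t)) + complex.Re b * complex.Im (g (rowofT t))))).
  by congr cubeint; apply/funext => t; rewrite ImD !ImM; ring.
by rewrite H !mul1r; congr (_ + _); rewrite addrC.
Qed.

(** The factor 2 comes from estimating the real and imaginary integrals separately; it recurs in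
    every bound on a Fourier coefficient. *)
Lemma cabs_Tint f (M : R) : cmeasurable f ->
  (cubeintE (fun t => (cabs (f (rowofT t)))%:E) <= M%:E)%E -> cabs (Tint f) <= 2 * M.
Proof.
move=> mf fM; apply: le_trans (ler_cabs_ReIm _) _; rewrite mulr_natl mulr2n /=.
apply: lerD; rewrite -lee_fin; apply: le_trans fM; (apply: le_trans (le_norm_cubeint _) _; first by case: mf);
  apply: le_cubeintE => //.
- by apply/measurable_EFinP; apply: measurableT_comp => //; case: mf.
- by apply/measurable_EFinP; exact: measurable_cabs.
- by move=> x; rewrite lee_fin ler_Re_cabs.
- by apply/measurable_EFinP; apply: measurableT_comp => //; case: mf.
- by apply/measurable_EFinP; exact: measurable_cabs.
- by move=> x; rewrite lee_fin ler_Im_cabs.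
Qed.

Lemma torus_integrable_fker xi f : torus_integrable f -> torus_integrable (fun x => fker xi x * f x).
Proof.
move=> [mf fi]; split; first by apply: cmeasurableM => //; exact: cmeasurable_fker.
by under eq_fun do rewrite cabsM cabs_cexpi mul1r.
Qed.

Lemma fourier_linear (a b : R[i]) f g xi : torus_integrable f -> torus_integrable g ->
  fourier (fun x => a * f x + b * g x) xi = a * fourier f xi + b * fourier g xi.
Proof.
move=> hf hg; rewrite /fourier -Tint_linear; first last.
- exact: torus_integrable_fker.
- exact: torus_integrable_fker.
by congr Tint; apply/funext => x; rewrite mulrDr !(mulrCA (cexpi _)).
Qed.

Lemma cabs_fourier f xi (M : R) : cmeasurable f ->
  (cubeintE (fun t => (cabs (f (rowofT t)))%:E) <= M%:E)%E -> cabs (fourier f xi) <= 2 * M.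
Proof.
move=> mf fM; apply: cabs_Tint.
  by apply: cmeasurableM => //; exact: cmeasurable_fker.
by under eq_fun do rewrite cabsM cabs_cexpi mul1r.
Qed.

Lemma cubeintE_cabs_bounded f (M : R) : cmeasurable f -> (forall x, cabs (f x) <= M) ->
  (cubeintE (fun t => (cabs (f (rowofT t)))%:E) <= M%:E)%E.
Proof.
move=> mf fM; rewrite -[leRHS](@cubeintE_cst R n); apply: le_cubeintE => //.
- by apply/measurable_EFinP; exact: measurable_cabs.
- by move=> x; rewrite lee_fin cabs_ge0.
- by move=> x; rewrite lee_fin.
Qed.

Lemma torus_integrable_bounded f (M : R) : cmeasurable f -> (forall x, cabs (f x) <= M) ->
  torus_integrable f.
Proof.
by move=> mf fM; split => //; apply: le_lt_trans (cubeintE_cabs_bounded mf fM) (ltry _).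
Qed.

Lemma cabs_fourier_bounded f xi (M : R) : cmeasurable f -> (forall x, cabs (f x) <= M) ->
  cabs (fourier f xi) <= 2 * M.
Proof. by move=> mf fM; apply: cabs_fourier => //; exact: cubeintE_cabs_bounded. Qed.

Lemma rowofT_tshift (i : 'I_n) h (t : n.-tuple R) :
  rowofT (tshift i h t) = rowofT t + h *: delta_mx 0 i.
Proof.
apply/rowP => j; rewrite !mxE tnth_mktuple eqxx /=; congr (_ + _).
by case: eqP => _; rewrite ?mulr1 ?mulr0.
Qed.

Lemma measurable_tshift (i : 'I_n) (h : R) :
  measurable_fun setT (tshift i h : n.-tuple (measurableTypeR R) -> n.-tuple (measurableTypeR R)).
Proof.
apply/measurable_fun_tnthP => j.
apply: (eq_measurable_fun (fun t : n.-tuple (measurableTypeR R) => tnth t j + (if j == i then h else 0))).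
  by move=> t _ /=; rewrite tnth_mktuple.
apply: measurable_funD; last exact: measurable_cst.
exact: measurable_tnth.
Qed.

Lemma cmeasurable_shift (i : 'I_n) h f : cmeasurable f ->
  cmeasurable (fun x => f (x + h *: delta_mx 0 i)).
Proof.
move=> [f1 f2]; split.
  apply: (eq_measurable_fun ((fun t => complex.Re (f (rowofT t))) \o tshift i h)).
    by move=> t _ /=; rewrite rowofT_tshift.
  exact: (measurableT_comp f1 (measurable_tshift i h)).
apply: (eq_measurable_fun ((fun t => complex.Im (f (rowofT t))) \o tshift i h)).
  by move=> t _ /=; rewrite rowofT_tshift.
exact: (measurableT_comp f2 (measurable_tshift i h)).
Qed.

Lemma dotZ_shift (i : 'I_n) h (x : 'rV[R]_n) xi :
  dotZ (x + h *: delta_mx 0 i) xi = dotZ x xi + h * (xi 0 i)%:~R.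
Proof.
rewrite /dotZ (bigD1 i)//= [in RHS](bigD1 i)//= !mxE !eqxx/= mulr1 mulrDl -!addrA.
congr (_ + _); rewrite addrC; congr (_ + _); apply: eq_bigr => j ji.
by rewrite !mxE (negbTE ji) andbF mulr0 addr0.
Qed.

Lemma fker_shift (i : 'I_n) h (x : 'rV[R]_n) xi :
  fker xi (x + h *: delta_mx 0 i) = cexpi (- (2 * pi * (h * (xi 0 i)%:~R))) * fker xi x.
Proof. by rewrite /fker dotZ_shift -cexpiD mulrDr opprD addrC. Qed.

Lemma echar_shift (i : 'I_n) h (x : 'rV[R]_n) xi :
  echar xi (x + h *: delta_mx 0 i) = cexpi (2 * pi * (h * (xi 0 i)%:~R)) * echar xi x.
Proof. by rewrite /echar dotZ_shift -cexpiD mulrDr addrC. Qed.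

Lemma periodic_echar xi : Defs.periodic (echar (R := R) xi).
Proof.
move=> x i; rewrite -[delta_mx 0 i]scale1r echar_shift mul1r.
by rewrite cexpi_int mul1r.
Qed.

Lemma periodic_fker xi : Defs.periodic (fker xi).
Proof.
move=> x i; rewrite -[delta_mx 0 i]scale1r fker_shift mul1r.
by rewrite -mulrN -intrN cexpi_int mul1r.
Qed.

Lemma Tint_shift f (M : R) (i : 'I_n) h : cmeasurable f -> (forall x, cabs (f x) <= M) ->
  Defs.periodic f -> 0 <= h <= 1 -> Tint (fun x => f (x + h *: delta_mx 0 i)) = Tint f.
Proof.
move=> mf fM pf h01; rewrite /Tint; congr (_ +i* _)%C.
  under eq_fun do rewrite -rowofT_tshift.
  apply: (@cubeint_tshift _ _ i h M (fun t => complex.Re (f (rowofT t)))) => //.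
  - by case: mf.
  - by move=> t; apply: le_trans (ler_Re_cabs _) (fM _).
  - by move=> t; rewrite rowofT_tshift scale1r pf.
under eq_fun do rewrite -rowofT_tshift.
apply: (@cubeint_tshift _ _ i h M (fun t => complex.Im (f (rowofT t)))) => //.
- by case: mf.
- by move=> t; apply: le_trans (ler_Im_cabs _) (fM _).
- by move=> t; rewrite rowofT_tshift scale1r pf.
Qed.

(** Translating the whole product of kernel and [f] leaves its integral unchanged, and the
    translated kernel differs from the original by the phase. *)
Lemma fourier_shift f (M : R) (i : 'I_n) h xi : cmeasurable f -> (forall x, cabs (f x) <= M) ->
  Defs.periodic f -> 0 <= h <= 1 ->
  fourier (fun x => f (x + h *: delta_mx 0 i)) xi = cexpi (2 * pi * (h * (xi 0 i)%:~R)) * fourier f xi.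
Proof.
move=> mf fM pf h01.
set c := cexpi _.
have mK : cmeasurable (fun x => fker xi x * f x).
  by apply: cmeasurableM => //; exact: cmeasurable_fker.
have KM x : cabs (fker xi x * f x) <= M by rewrite cabsM cabs_cexpi mul1r.
have pK : Defs.periodic (fun x => fker xi x * f x) by move=> x j; rewrite periodic_fker pf.
have iK := torus_integrable_bounded mK KM.
rewrite {2}/fourier -[Tint _]/(Tint (fun x => fker xi x * f x)).
have mKh := cmeasurable_shift i h mK.
have iKh := torus_integrable_bounded mKh (fun x => KM _).
rewrite -(Tint_shift i mK KM pK h01).
have := Tint_linear c 0 iKh iKh; rewrite mul0r addr0 => <-.
congr Tint; apply/funext => x; rewrite mul0r addr0 fker_shift mulrA mulrA /c -cexpiD.
by rewrite subrr /cexpi cos0 sin0 mul1r.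
Qed.

Lemma iter_sdiff_regular f (M : R) (i : 'I_n) h k : cmeasurable f ->
  (forall x, cabs (f x) <= M) -> Defs.periodic f ->
  [/\ cmeasurable (iter k (sdiff (delta_mx 0 i) h) f),
      forall x, cabs (iter k (sdiff (delta_mx 0 i) h) f x) <= 2 ^+ k * M &
      Defs.periodic (iter k (sdiff (delta_mx 0 i) h) f)].
Proof.
move=> mf fM pf; elim: k => [|k [IH1 IH2 IH3]] /=.
  by split => // x; rewrite mul1r.
split.
- rewrite /sdiff; under eq_fun do rewrite -mulN1r.
  apply: cmeasurableD; first exact: (cmeasurable_shift i h IH1).
  by apply: cmeasurableM => //; exact: cmeasurable_cst.
- move=> x; apply: le_trans (ler_cabsB _ _) _.
  by rewrite exprS -mulrA mulr_natl mulr2n; exact: lerD.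
- by move=> x j; rewrite /sdiff addrAC !IH3.
Qed.

(* For [h = 1 / (2 |xi_i|)] the difference operator in direction [i] multiplies
   the Fourier coefficient at [xi] by [exp (2 pi i h xi_i) - 1 = -2]. *)
Lemma fourier_decay f (M B : R) (i : 'I_n) k xi : cmeasurable f ->
  (forall x, cabs (f x) <= M) -> Defs.periodic f -> xi 0 i != 0 ->
  (forall h, 0 <= h -> forall x, cabs (iter k (sdiff (delta_mx 0 i) h) f x) <= h ^+ k * B) ->
  `|(xi 0 i)%:~R| ^+ k * cabs (fourier f xi) <= 2 * B.
Proof.
move=> mf fM pf xi0 hB.
pose z : R := `|(xi 0 i)%:~R|.
have z1 : 1 <= z.
  by rewrite /z -intr_norm -[1]/(1%:~R) ler_int -gtz0_ge1 normr_gt0.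
have z0 : 0 < z by exact: lt_le_trans z1.
pose h : R := (2 * z)^-1.
have h0 : 0 <= h by rewrite invr_ge0 mulr_ge0// ltW.
(* [fourier_shift] takes shifts in [[0, 1]]; a nonzero integer has modulus at least 1. *)
have h1 : h <= 1 by rewrite invf_le1 ?mulr_gt0//; lra.
have ce : cexpi (2 * pi * (h * (xi 0 i)%:~R)) = -1 :> R[i].
  have [xip|xin] := lerP 0 ((xi 0 i)%:~R : R).
    have zE : z = (xi 0 i)%:~R by rewrite /z ger0_norm.
    rewrite -zE /h (_ : _ * _ = pi) ?cexpi_pi//; by field; rewrite gt_eqF.
  have zE : z = - (xi 0 i)%:~R by rewrite /z ltr0_norm.
  rewrite -[(xi 0 i)%:~R]opprK -zE /h (_ : _ * _ = - pi) ?cexpiNpi//; by field; rewrite gt_eqF.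
have Fk j : fourier (iter j (sdiff (delta_mx 0 i) h) f) xi = (- 2) ^+ j * fourier f xi.
  elim: j => [|j IH]; first by rewrite mul1r.
  have [m1 m2 m3] := iter_sdiff_regular i h j mf fM pf.
  set F := iter j _ f in m1 m2 m3 IH *.
  have := fourier_linear 1 (-1) xi
    (torus_integrable_bounded (cmeasurable_shift i h m1) (fun x => m2 _))
    (torus_integrable_bounded m1 m2).
  rewrite (fourier_shift i xi m1 m2 m3); last by rewrite h0.
  rewrite iterS -/F ce IH exprS => E.
  transitivity (1 * (-1 * ((- 2) ^+ j * fourier f xi)) + -1 * ((- 2) ^+ j * fourier f xi)).
    rewrite -E; congr fourier; apply/funext => x.
    by rewrite /sdiff mul1r mulN1r.
  by rewrite mul1r -mulrDl -mulrA; congr (_ * _); rewrite -opprD.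
have [m1 m2 m3] := iter_sdiff_regular i h k mf fM pf.
have := cabs_fourier_bounded xi m1 (hB h h0).
rewrite Fk cabsM cabsX cabsN.
have -> : cabs (2 : R[i]) = 2.
  by apply: complexI; rewrite -normc_cabs normr_nat rmorph_nat.
rewrite -/z mulrCA => H.
(* As [h * z = 1/2], the left side becomes [2^(-k)] times the modulus of the coefficient, well below
   the [2^k] times it that [H] controls. *)
rewrite -(@ler_pM2l _ (h ^+ k)) ?exprn_gt0 ?invr_gt0 ?mulr_gt0//.
apply: le_trans H; rewrite mulrA -exprMn ler_wpM2r ?cabs_ge0//.
rewrite (_ : h * z = 2^-1); last by rewrite /h; field; rewrite gt_eqF.
by apply: lerXn2r; rewrite ?nnegrE; lra.
Qed.

End Fourier.

(** * Summation over the lattice *)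

Section LatticeSums.
Variable R : realType.

Lemma powR2_le1 (x : R) : x <= 0 -> powR 2 x <= 1.
Proof. by move=> x0; rewrite -[leRHS](powRr0 2); apply: ler_powR; rewrite ?ler1n. Qed.

(** With [q = 2^(1-s) < 1], doubling the range gives [S N <= S (2N+1) <= 1 + q * S N], which solves
    to [S N <= 1 / (1 - q)]. *)
Lemma power_sum_bounded (s : R) : 1 < s ->
  forall N, \sum_(z < N) powR z.+1%:R (- s) <= (1 - powR 2 (1 - s))^-1.
Proof.
move=> s1.
have q1 : powR 2 (1 - s) < 1 :> R.
  by rewrite /powR pnatr_eq0/= expR_lt1 nmulr_rlt0 ?subr_lt0// ln_gt0// ltr1n.
have q0 : 0 < powR 2 (1 - s) :> R by exact: powR_gt0.
have qE : 2 * powR 2 (- s) = powR 2 (1 - s) :> R.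
  by rewrite powRD ?pnatr_eq0 ?implybT// powRr1.
pose S N : R := \sum_(z < N) powR z.+1%:R (- s).
have Sincr N M : (N <= M)%N -> S N <= S M.
  move=> NM; rewrite /S -(big_mkord predT (fun z => powR z.+1%:R (- s))) -(big_mkord predT (fun z => powR z.+1%:R (- s))).
  by rewrite [leRHS](big_cat_nat (n := N))//= lerDl sumr_ge0// => z _; exact: powR_ge0.
(* Group the terms of index 2z and 2z+1, both at most the one of index 2z. *)
have Sdouble N : S N.*2.+1 <= 1 + powR 2 (1 - s) * S N.
  elim: N => [|N IH].
    by rewrite /S big_ord_recl !big_ord0 addr0 mulr0 addr0 powR1.
  rewrite doubleS /S 2!big_ord_recr /= -/(S _) [X in _ * X]big_ord_recr/= -/(S N).
  rewrite mulrDr addrA -[leLHS]addrA; apply: lerD => //.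
  rewrite -qE -mulrA mulr_natl mulr2n -powRM//.
  have e1 : (2 * N.+1%:R : R) = (N.*2).+2%:R by rewrite -natrM mul2n doubleS.
  rewrite e1 lerD2l !powRN lef_pV2 ?posrE ?powR_gt0//.
  by apply: ge0_ler_powR; rewrite ?nnegrE ?ler_nat// ltW// (lt_trans ltr01).
move=> N; rewrite -/(S N) -[leRHS]mul1r ler_pdivlMr ?subr_gt0//.
have := Sdouble N; have := Sincr N N.*2.+1; rewrite -addnn -addSn leq_addl => /(_ isT).
by rewrite addSn; set x := S N; set y := S _; set q := powR _ _; nra.
Qed.

Lemma jbr_ge1 n (xi : 'rV[int]_n) : 1 <= jbr R xi.
Proof.
rewrite -[leLHS]sqrtr1 ler_wsqrtr// lerDl ler0z.
by apply: sumr_ge0 => i _; exact: sqr_ge0.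
Qed.

Lemma jbr_gt0 n (xi : 'rV[int]_n) : 0 < jbr R xi.
Proof. exact: lt_le_trans (jbr_ge1 xi). Qed.

Lemma jbr_sqr n (xi : 'rV[int]_n) : jbr R xi ^+ 2 = 1 + \sum_i ((xi 0 i)%:~R) ^+ 2.
Proof.
rewrite sqr_sqrtr; last first.
  rewrite addr_ge0// ler0z; by apply: sumr_ge0 => i _; exact: sqr_ge0.
by rewrite /normsqZ raddf_sum/=; congr (_ + _); apply: eq_bigr => i _; rewrite rmorphXn.
Qed.

(** With [A] and [B] the squared lengths of [xi] and [eta - xi], the square of the claim follows
    from [1 + 2A + 2B <= 4 (1 + A) (1 + B)]; the coordinatewise bound [x^2 <= 2 y^2 + 2 (x - y)^2]
    is [(x - 2y)^2 >= 0]. *)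
Lemma jbr_peetre n (xi eta : 'rV[int]_n) : jbr R eta <= 2 * (jbr R xi * jbr R (eta - xi)).
Proof.
rewrite -(@ler_pXn2r _ 2) ?nnegrE//; try by rewrite ?mulr_ge0 ?ltW ?jbr_gt0.
rewrite !exprMn !jbr_sqr.
set A := \sum_i ((xi 0 i)%:~R) ^+ 2; set B := \sum_i (((eta - xi) 0 i)%:~R) ^+ 2.
have A0 : 0 <= A by apply: sumr_ge0 => i _; exact: sqr_ge0.
have B0 : 0 <= B by apply: sumr_ge0 => i _; exact: sqr_ge0.
have H : \sum_i ((eta 0 i)%:~R : R) ^+ 2 <= 2 * A + 2 * B.
  rewrite !mulr_sumr -big_split/=; apply: ler_sum => i _.
  rewrite !mxE intrD rmorphN /=.
  set x := (eta 0 i)%:~R : R; set y := (xi 0 i)%:~R : R.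
  have := sqr_ge0 (x - 2 * y); nra.
nra.
Qed.

(** Every absolute value up to [N] occurs at most twice. The induction removes both end points of
    the range, where the absolute value is [N.+1]. *)
Lemma absz_boxpt_sum (F : nat -> R) (N : nat) : (forall k, 0 <= F k) ->
  \sum_(c < (2 * N).+1) F `|(c : nat)%:Z - N%:Z|%N <= 2 * \sum_(z < N.+1) F z.
Proof.
move=> F0; elim: N => [|N IH].
  rewrite muln0 !big_ord_recl !big_ord0 !addr0 /= mulr_natl mulr2n lerDl.
  exact: F0.
rewrite mulnS !addSn add0n.
rewrite big_ord_recl big_ord_recr /= [in leRHS]big_ord_recr/= mulrDr.
have e1 : `|(bump 0 (2 * N).+1)%:Z - N.+1%:Z|%N = N.+1 by rewrite /bump/=; lia.
have e2 : \sum_(c < (2 * N).+1) F `|(bump 0 c)%:Z - N.+1%:Z|%N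
    = \sum_(c < (2 * N).+1) F `|(c : nat)%:Z - N%:Z|%N.
  apply: eq_bigr => c _; congr (F _); rewrite /bump /=; lia.
rewrite subn0 e1 e2; set x := F N.+1; lra.
Qed.

(** The index cube of [Tpart] as a list, so that it can be compared by inclusion with other
    enumerations of Z^n. *)
Definition boxseq n N : seq 'rV[int]_n := [seq @boxpt n N j | j <- index_enum {ffun 'I_n -> 'I_(2 * N).+1}].

Lemma big_boxseq (V : nmodType) n N (F : 'rV[int]_n -> V) :
  \sum_(xi <- boxseq n N) F xi = \sum_(j : {ffun 'I_n -> 'I_(2 * N).+1}) F (boxpt j).
Proof. by rewrite big_map. Qed.

Lemma boxseq_uniq n N : uniq (boxseq n N).
Proof.
rewrite map_inj_uniq ?index_enum_uniq// => j1 j2 /rowP E; apply/ffunP => i.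
have := E i; rewrite !mxE => /addIr H; apply/val_inj; by case: H.
Qed.

Lemma mem_boxseq n N (xi : 'rV[int]_n) :
  (forall i, (absz (xi ord0 i) <= N)%N) -> xi \in boxseq n N.
Proof.
move=> xiN; apply/mapP.
exists [ffun i => inord (absz (xi ord0 i + N%:Z))]; first exact: mem_index_enum.
apply/rowP => i; rewrite !mxE ffunE; have := xiN i.
rewrite (_ : ord0 = 0 :> 'I_1)//; set x := xi 0 i => xN; rewrite inordK; lia.
Qed.

Lemma sub_boxseq n (A : seq 'rV[int]_n) :
  exists N0, forall N, (N0 <= N)%N -> {subset A <= boxseq n N}.
Proof.
elim: A => [|xi A [N0 H]]; first by exists 0%N => N _ y.
exists (maxn N0 (\max_i absz (xi ord0 i))) => N; rewrite geq_max => /andP[h1 h2] y.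
rewrite inE => /orP[/eqP ->|]; last exact: H.
by apply: mem_boxseq => i; apply: leq_trans h2; exact: (leq_bigmax i).
Qed.

Lemma ler_sum_sub (T : eqType) (A B : seq T) (W : T -> R) :
  (forall x, 0 <= W x) -> uniq A -> uniq B -> {subset A <= B} ->
  \sum_(x <- A) W x <= \sum_(x <- B) W x.
Proof.
move=> W0 uA uB AB.
have pA : perm_eq [seq x <- B | x \in A] A.
  apply: uniq_perm => //; first exact: filter_uniq.
  by move=> x; rewrite mem_filter; case: (boolP (x \in A)) => // /AB ->.
rewrite -(perm_big _ pA)/= big_filter [leRHS](bigID (fun x => x \in A))/= lerDl.
by apply: sumr_ge0.
Qed.

Lemma jbr_ge_coord n (xi : 'rV[int]_n) i : ((absz (xi ord0 i)).+1)%:R <= 2 * jbr R xi.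
Proof.
rewrite -(@ler_pXn2r _ 2) ?nnegrE ?mulr_ge0 ?(ltW (jbr_gt0 _))//.
rewrite exprMn jbr_sqr.
have : (absz (xi ord0 i))%:R ^+ 2 <= \sum_i ((xi 0 i)%:~R) ^+ 2 :> R.
  rewrite (bigD1 i)//= natr_absz intr_norm real_normK ?num_real// lerDl.
  by apply: sumr_ge0 => j _; exact: sqr_ge0.
rewrite -natr1; set x := _%:R; set y := \sum_i _ => xy.
have := sqr_ge0 (x - 1); nra.
Qed.

Lemma jbr_sum_bounded n (tau : R) : (0 < n)%N -> n%:R < tau ->
  exists K : R, forall A : seq 'rV[int]_n, uniq A ->
    \sum_(xi <- A) powR (jbr R xi) (- tau) <= K.
Proof.
move=> n0 ntau; pose s := tau / n%:R.
have n0' : 0 < n%:R :> R by rewrite ltr0n.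
have s1 : 1 < s by rewrite ltr_pdivlMr// mul1r.
have s0 : 0 < s by exact: lt_trans ltr01 s1.
pose F (k : nat) : R := powR (k.+1%:R / 2) (- s).
have F0 k : 0 <= F k by exact: powR_ge0.
(* The factor 2 counts the two signs, the power of [2^-1] comes from the halves in [F], and the rest
   is the bound of [power_sum_bounded]. *)
pose K1 : R := 2 * (powR 2^-1 (- s) * (1 - powR 2 (1 - s))^-1).
exists (K1 ^+ n) => A uA.
have [N /(_ N (leqnn N)) AN] := sub_boxseq A.
apply: le_trans (ler_sum_sub (fun xi => powR_ge0 _ _) uA (boxseq_uniq n N) AN) _.
rewrite big_boxseq.
apply: (@le_trans _ _ (\sum_(j : {ffun 'I_n -> 'I_(2 * N).+1}) \prod_(i < n) F `|(j i : nat)%:Z - N%:Z|%N)).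
  apply: ler_sum => j _; set xi := boxpt j.
  have -> : - tau = - s * n%:R by rewrite /s mulNr divfK ?gt_eqF.
  rewrite powRrM powR_mulrn ?powR_ge0// -[n in _ ^+ n]card_ord -prodr_const.
  apply: ler_prod => i _; rewrite powR_ge0/= /F.
  have -> : `|(j i : nat)%:Z - N%:Z|%N = absz (xi ord0 i) by rewrite mxE.
  rewrite !powRN lef_pV2 ?posrE ?powR_gt0 ?jbr_gt0// ?divr_gt0//.
  apply: ge0_ler_powR; rewrite ?nnegrE ?(ltW s0) ?(ltW (jbr_gt0 _))//.
  by rewrite ler_pdivrMr// mulrC jbr_ge_coord.
rewrite -(bigA_distr_bigA (fun i : 'I_n => fun c : 'I_(2 * N).+1 => F `|(c : nat)%:Z - N%:Z|%N)).
rewrite prodr_const card_ord lerXn2r ?nnegrE//.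
- by apply: sumr_ge0.
- rewrite /K1 !mulr_ge0 ?powR_ge0// invr_ge0 subr_ge0.
  by rewrite powR2_le1// subr_le0 ltW.
apply: le_trans (absz_boxpt_sum N F0) _.
rewrite /K1 ler_pM2l// /F.
under eq_bigr do rewrite powRM// mulrC.
by rewrite -mulr_sumr ler_wpM2l ?powR_ge0// power_sum_bounded.
Qed.

(* [pickle_inv] enumerates Z^n with gaps, which contribute zero terms to [zterm]. *)
Definition zseq n N : seq 'rV[int]_n := pmap pickle_inv (iota 0 N).

Definition zterm n (V : nmodType) (F : 'rV[int]_n -> V) (j : nat) : V := oapp F 0 (pickle_inv j).

Lemma sum_zterm n (V : nmodType) (F : 'rV[int]_n -> V) N :
  \sum_(j < N) zterm F j = \sum_(xi <- zseq n N) F xi.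
Proof. by rewrite big_pmap -(big_mkord predT (zterm F)) /index_iota subn0. Qed.

Lemma zseq_uniq n N : uniq (zseq n N).
Proof. by apply: pmap_uniq (iota_uniq _ _); exact: pickle_invK. Qed.

Lemma mem_zseq n N (xi : 'rV[int]_n) : (xi \in zseq n N) = (pickle xi < N)%N.
Proof.
rewrite mem_pmap; apply/mapP/idP => [[j]|xiN].
  rewrite mem_iota add0n => /andP[_ jN] E.
  by have := pickle_invK (T := 'rV[int]_n) j; rewrite -E /= => ->.
by exists (pickle xi); rewrite ?mem_iota// pickleK_inv.
Qed.

Lemma sub_zseq n (A : seq 'rV[int]_n) : exists N0, forall N, (N0 <= N)%N -> {subset A <= zseq n N}.
Proof.
elim: A => [|xi A [N0 H]]; first by exists 0%N => N _ y.
exists (maxn N0 (pickle xi).+1) => N; rewrite geq_max => /andP[h1 h2] y.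
by rewrite inE => /orP[/eqP ->|]; [rewrite mem_zseq | exact: H].
Qed.

(** * Unconditional summation of families dominated by a summable weight *)

Section Unconditional.
Variables (n : nat) (W : 'rV[int]_n -> R) (K : R).
Hypothesis W0 : forall xi, 0 <= W xi.
Hypothesis WK : forall A, uniq A -> \sum_(xi <- A) W xi <= K.

Lemma zterm_ge0 j : 0 <= zterm W j.
Proof. by rewrite /zterm; case: pickle_inv => /=. Qed.

Lemma psum_cvg (F : 'rV[int]_n -> R) (M : R) : (forall xi, 0 <= F xi <= M * W xi) ->
  cvgn (fun N => \sum_(j < N) zterm F j).
Proof.
move=> FM; apply: nondecreasing_is_cvgn.
  apply/nondecreasing_seqP => N; rewrite big_ord_recr lerDl /zterm.
  by case: pickle_inv => //= xi; case/andP: (FM xi).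
exists (`|M| * K) => _ [N _ <-]; rewrite sum_zterm.
apply: (@le_trans _ _ (\sum_(xi <- zseq n N) `|M| * W xi)).
  apply: ler_sum => xi _; case/andP: (FM xi) => _ h; apply: le_trans h _.
  by rewrite ler_wpM2r// ler_norm.
by rewrite -mulr_sumr ler_wpM2l// WK// zseq_uniq.
Qed.

Definition ztail N : R := limn (fun M => \sum_(j < M) zterm W j) - \sum_(j < N) zterm W j.

Lemma zsum_cvg : cvgn (fun N => \sum_(j < N) zterm W j).
Proof. by apply: (psum_cvg (M := 1)) => xi; rewrite mul1r W0/=. Qed.

Lemma ztail_cvg0 : ztail @ \oo --> (0 : R).
Proof.
rewrite /ztail -[X in _ --> X](subrr (limn (fun M => \sum_(j < M) zterm W j))).
apply: cvgB; first exact: cvg_cst.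
exact: zsum_cvg.
Qed.

(** [A] together with the first points of the enumeration is still duplicate-free, so it sits inside
    a longer initial segment, whose sum is at most the limit. *)
Lemma le_ztail N A : uniq A -> {in A, forall xi, (N <= pickle xi)%N} ->
  \sum_(xi <- A) W xi <= ztail N.
Proof.
move=> uA AN; rewrite /ztail lerBrDr addrC sum_zterm -big_cat/=.
have [N0 /(_ N0 (leqnn _)) h] := sub_zseq (zseq n N ++ A).
apply: (@le_trans _ _ (\sum_(xi <- zseq n N0) W xi)).
  apply: ler_sum_sub => //; last exact: zseq_uniq.
  rewrite cat_uniq zseq_uniq uA andbT /=; apply/hasPn => xi /AN.
  by rewrite mem_zseq -leqNgt.
rewrite -sum_zterm; apply: (nondecreasing_cvgn_le (u_ := fun M => \sum_(j < M) zterm W j)).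
  by apply/nondecreasing_seqP => M; rewrite big_ord_recr lerDl zterm_ge0.
exact: zsum_cvg.
Qed.

Lemma sum_sub_le_ztail (F : 'rV[int]_n -> R) (C : R) N A : 0 <= C ->
  (forall xi, `|F xi| <= C * W xi) -> uniq A -> {subset zseq n N <= A} ->
  `|\sum_(xi <- A) F xi - \sum_(xi <- zseq n N) F xi| <= C * ztail N.
Proof.
move=> C0 FC uA NA.
have pA : perm_eq [seq x <- A | x \in zseq n N] (zseq n N).
  apply: uniq_perm; [exact: filter_uniq|exact: zseq_uniq|].
  by move=> x; rewrite mem_filter; case: (boolP (x \in zseq n N)) => // /NA ->.
rewrite -(perm_big _ pA)/= big_filter (bigID (fun x => x \in zseq n N))/= addrC addrK.
rewrite -big_filter; apply: le_trans (ler_norm_sum _ _ _) _.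
apply: (@le_trans _ _ (\sum_(xi <- [seq x <- A | x \notin zseq n N]) C * W xi)).
  by apply: ler_sum => xi _.
rewrite -mulr_sumr ler_wpM2l// le_ztail ?filter_uniq// => xi.
by rewrite mem_filter mem_zseq -leqNgt => /andP[].
Qed.

(** Reconciles two orders of summation: cubes, which define [Top], and the enumeration, which
    indexes the nuclear series. The rate depends on [F] only through [C], which later makes the
    convergence uniform in [x]. *)
Lemma box_sum_lim (F : 'rV[int]_n -> R) (C : R) : 0 <= C ->
  (forall xi, `|F xi| <= C * W xi) ->
  exists l : R, (fun N => \sum_(xi <- boxseq n N) F xi) @ \oo --> l /\
    forall N, `|l - \sum_(xi <- zseq n N) F xi| <= C * ztail N.
Proof.
move=> C0 FC.
(* A signed series reduces to monotone ones: [F + C * W] lies between 0 and [2 * C * W], and [C * W]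
   is subtracted afterwards. *)
have cF : cvgn (fun N => \sum_(j < N) zterm F j).
  have c1 : cvgn (fun N => \sum_(j < N) zterm (fun xi => F xi + C * W xi) j).
    apply: (psum_cvg (M := 2 * C)) => xi; have := FC xi; rewrite ler_norml => /andP[h1 h2].
    by apply/andP; split; lra.
  have c2 : cvgn (fun N => \sum_(j < N) zterm (fun xi => C * W xi) j).
    apply: (psum_cvg (M := C)) => xi; rewrite lexx andbT; exact: mulr_ge0.
  rewrite (_ : (fun N => _) = (fun N => \sum_(j < N) zterm (fun xi => F xi + C * W xi) j)
     \- (fun N => \sum_(j < N) zterm (fun xi => C * W xi) j)); first exact: is_cvgB.
  apply/funext => N /=; rewrite !sum_zterm -sumrB; apply: eq_bigr => xi _; by rewrite addrK.
set l := limn _ in cF; exists l.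
have lN N : `|l - \sum_(xi <- zseq n N) F xi| <= C * ztail N.
  have cl : (fun M => `|\sum_(j < M) zterm F j - \sum_(xi <- zseq n N) F xi|) @ \oo
      --> `|l - \sum_(xi <- zseq n N) F xi|.
    by apply: cvg_norm; apply: cvgB => //; exact: cvg_cst.
  apply: (cvgr_to_le cl); exists N => // M NM; rewrite sum_zterm.
  apply: sum_sub_le_ztail => //; first exact: zseq_uniq.
  by move=> xi; rewrite !mem_zseq => /leq_trans; exact.
split => //; apply/cvgrPdist_le => e e0.
(* Once a cube contains the points of [zseq n N0], its sum and [l] are both within [C * ztail N0] of
   the same partial sum; hence the factor 2. *)
have ct : (fun N => 2 * C * ztail N) @ \oo --> (0 : R).
  by rewrite -[X in _ --> X](mulr0 (2 * C)); apply: cvgMr; exact: ztail_cvg0.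
have /cvgrPdist_le/(_ e e0) [N0 _ /(_ N0 (leqnn _))] := ct.
rewrite /= sub0r normrN => hN0; have := le_trans (ler_norm _) hN0 => {}hN0.
have [N1 hN1] := sub_boxseq (zseq n N0).
exists N1 => // N /= N1N.
have := sum_sub_le_ztail C0 FC (boxseq_uniq n N) (hN1 N N1N).
have := lN N0.
set s := \sum_(xi <- zseq n N0) F xi; set b := \sum_(xi <- boxseq n N) F xi => h1 h2.
apply: le_trans hN0; rewrite (_ : l - b = (l - s) - (b - s)); last by ring.
apply: le_trans (ler_normB _ _) _; rewrite -mulrA; set t := C * _ in h1 h2 *; lra.
Qed.

End Unconditional.

End LatticeSums.

(** * Besov norms *)

Section BesovBound.
Variable R : realType.
Variable n : nat.
Implicit Types (f : fn R n).

(** A bound on the l^1 norm of the Fourier coefficients with weight [<xi>^v]. Finite sums over cubes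
    stand for the infinite series, and these cubes contain the index sets of the dyadic blocks. *)
Definition fourier_bounded (v : R) f (S : R) :=
  forall N, \sum_(xi <- boxseq n N) powR (jbr R xi) v * cabs (fourier f xi) <= S.

Lemma cabs_echar xi (x : 'rV[R]_n) : cabs (echar xi x) = 1.
Proof. exact: cabs_cexpi. Qed.

Lemma cmeasurable_dyad f m : cmeasurable (dyad f m).
Proof.
rewrite /dyad; under eq_fun do rewrite big_mkcond/=.
apply: (@cmeasurable_sum R n _ _ (fun j x => if _ then echar (boxpt j) x * fourier f (boxpt j) else 0)) => j.
set b := (_ && _); case: b; last exact: cmeasurable_cst.
by apply: cmeasurableM; [exact: cmeasurable_echar | exact: cmeasurable_cst].
Qed.

(** On the block of index [m] one has [<xi> >= 2^m], so the weight leaves the sum as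
    [2^(m (v + eps))]. *)
Lemma dyad_bound (v eps S : R) f m : 0 <= v -> 0 <= eps -> fourier_bounded (v + eps) f S ->
  forall x, cabs (dyad f m x) <= powR 2 (- (m%:R * (v + eps))) * S.
Proof.
move=> v0 eps0 hS x; apply: le_trans (ler_cabs_sum _ _ _) _.
rewrite powRN mulrC ler_pdivlMr ?powR_gt0// mulrC mulr_sumr.
apply: le_trans (hS (2 ^ m.+1)%N).
rewrite big_boxseq big_mkcond/=; apply: ler_sum => j _.
case: ifP => [/andP[hj _]|_]; last by rewrite mulr_ge0 ?powR_ge0 ?cabs_ge0.
rewrite cabsM cabs_echar mul1r ler_wpM2r ?cabs_ge0// powRrM powR_mulrn//.
apply: ge0_ler_powR; rewrite ?nnegrE ?addr_ge0 ?exprn_ge0 ?(ltW (jbr_gt0 _ _))//.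
rewrite -(@ler_pXn2r _ 2) ?nnegrE ?exprn_ge0 ?(ltW (jbr_gt0 _ _))//.
rewrite /jbr sqr_sqrtr; last first.
  by rewrite addr_ge0// ler0z; apply: sumr_ge0 => i _; exact: sqr_ge0.
apply: (@le_trans _ _ ((4 ^ m)%N%:Z%:~R)); last first.
  by apply: (@le_trans _ _ (normsqZ (boxpt j))%:~R); [rewrite ler_int|rewrite lerDr].
by rewrite -pmulrn (natrX R 4 m) -exprM mulnC exprM -(natrX R 2 2).
Qed.

(** The unit cube has measure 1, so a sup bound dominates every [L^p] norm. *)
Lemma Lpnorm_bounded f (p : \bar R) (M : R) : (1 <= p)%E -> cmeasurable f ->
  (forall x, cabs (f x) <= M) -> (Lpnorm p f <= M%:E)%E.
Proof.
move=> p1 mf fM.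
have M0 : 0 <= M by apply: le_trans (cabs_ge0 _) (fM 0).
case: p p1 => [p| |] //= p1; last first.
  by apply: ge_ereal_sup => _ [x _ <-]; rewrite lee_fin.
rewrite lee_fin in p1; have p0 : 0 < p by exact: lt_le_trans p1.
have -> : M%:E = ((powR M p)%:E `^ p^-1)%E.
  by rewrite poweR_EFin -powRrM mulfV ?gt_eqF// powRr1.
apply: gt0_ler_poweR; rewrite ?invr_ge0 ?(ltW p0)//.
- by rewrite in_itv/= leey andbT; apply: cubeintE_ge0 => x; rewrite lee_fin powR_ge0.
- by rewrite in_itv/= leey andbT lee_fin powR_ge0.
- rewrite -[leRHS](@cubeintE_cst R n); apply: le_cubeintE => //.
  + apply/measurable_EFinP; apply: (measurableT_comp (f := fun x : R => powR x p)).
      exact: measurable_powR.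
    exact: measurable_cabs.
  + by move=> t; rewrite lee_fin powR_ge0.
  + by move=> t; rewrite lee_fin; apply: ge0_ler_powR; rewrite ?nnegrE ?(ltW p0) ?cabs_ge0.
Qed.

Lemma Lpnorm_ge0 f (p : \bar R) : (0 <= Lpnorm p f)%E.
Proof.
case: p => [p| |] //=; first exact: poweR_ge0.
by apply: le_trans (ereal_sup_ubound _); last (by exists 0); rewrite lee_fin cabs_ge0.
Qed.

Lemma besov_ge0 (w : R) (p q : \bar R) f : (0 <= besov w p q f)%E.
Proof.
case: q => [q| |] //=; first exact: poweR_ge0.
apply: (@le_trans _ _ ((powR 2 (0%:R * w))%:E * Lpnorm p (dyad f 0))%E).
  by rewrite mule_ge0 ?Lpnorm_ge0// lee_fin powR_ge0.
by apply: ereal_sup_ubound; exists 0%N.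
Qed.

(* The margin [eps] makes the dyadic blocks decay geometrically. *)
Lemma besov_le (w eps : R) (p q : \bar R) : 0 <= w -> 0 < eps -> (1 <= p)%E -> (1 <= q)%E ->
  exists2 C : R, 0 <= C & forall f S, fourier_bounded (w + eps) f S -> (besov w p q f <= (C * S)%:E)%E.
Proof.
move=> w0 eps0 p1 q1.
have block f S m : fourier_bounded (w + eps) f S ->
    ((powR 2 (m%:R * w))%:E * Lpnorm p (dyad f m) <= (powR 2 (- (m%:R * eps)) * S)%:E)%E.
  move=> hS; have := Lpnorm_bounded p1 (cmeasurable_dyad f m) (dyad_bound m w0 (ltW eps0) hS).
  move=> h; apply: (@le_trans _ _ ((powR 2 (m%:R * w))%:E * (powR 2 (- (m%:R * (w + eps))) * S)%:E)%E).
    by apply: lee_wpmul2l => //; rewrite lee_fin powR_ge0.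
  rewrite -EFinM lee_fin mulrA -powRD ?pnatr_eq0 ?implybT//.
  by rewrite mulrDr opprD addrA subrr add0r.
have S0 f S : fourier_bounded (w + eps) f S -> 0 <= S.
  move=> /(_ 0%N); apply: le_trans; apply: sumr_ge0 => xi _.
  by rewrite mulr_ge0 ?powR_ge0 ?cabs_ge0.
case: q q1 => [q| |] //= q1; last first.
  exists 1 => // f S hS; rewrite mul1r; apply: ge_ereal_sup => _ [m _ <-].
  apply: le_trans (block f S m hS) _; rewrite lee_fin ler_piMl ?(S0 f)//.
  by rewrite powR2_le1// oppr_le0 mulr_ge0// ltW.
rewrite lee_fin in q1; have q0 : 0 < q by exact: lt_le_trans q1.
(* Ratio of the geometric series formed by the [q]-th powers of the blocks; its sum [1 / (1 - z)] to
   the power [1 / q] is the constant. *)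
pose z : R := powR (powR 2 (- eps)) q.
have z0 : 0 < z by rewrite !powR_gt0.
have z1 : z < 1.
  rewrite /z -powRrM /powR pnatr_eq0/= expR_lt1 nmulr_rlt0 ?ln_gt0 ?ltr1n//.
  by rewrite nmulr_rlt0 ?oppr_lt0.
exists (powR ((1 - z)^-1) q^-1); first exact: powR_ge0.
move=> f S hS; have S0' := S0 f S hS.
have -> : (powR (1 - z)^-1 q^-1 * S)%:E = (((1 - z)^-1 * powR S q)%:E `^ q^-1)%E.
  rewrite poweR_EFin powRM ?powR_ge0 ?invr_ge0 ?subr_ge0 ?(ltW z1)//.
  by rewrite -powRrM mulfV ?gt_eqF// powRr1.
apply: gt0_ler_poweR; rewrite ?invr_ge0 ?(ltW q0)//.
- by rewrite in_itv/= leey andbT; apply: nneseries_ge0 => m _ _; exact: poweR_ge0.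
- by rewrite in_itv/= leey andbT lee_fin mulr_ge0 ?powR_ge0// invr_ge0 subr_ge0 ltW.
apply: lime_le.
  by apply: is_cvg_nneseries => m _ _; exact: poweR_ge0.
apply: nearW => N.
apply: (@le_trans _ _ (\sum_(0 <= m < N) (z ^+ m * powR S q)%:E)%E).
  apply: lee_sum => m _.
  have -> : (z ^+ m * powR S q)%:E = ((powR 2 (- (m%:R * eps)) * S)%:E `^ q)%E.
    rewrite poweR_EFin powRM ?powR_ge0//; congr (_ * _)%:E.
    by rewrite mulrC -mulNr powRrM powRAC powR_mulrn ?powR_ge0.
  apply: gt0_ler_poweR; rewrite ?(ltW q0)//.
  - by rewrite in_itv/= leey andbT mule_ge0 ?Lpnorm_ge0// lee_fin powR_ge0.
  - by rewrite in_itv/= leey andbT lee_fin mulr_ge0 ?powR_ge0.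
  - exact: block.
rewrite sumEFin lee_fin -mulr_suml ler_wpM2r ?powR_ge0//.
rewrite big_mkord.
have E : (1 - z) * (\sum_(i < N) z ^+ i) = 1 - z ^+ N.
  have := subrXX 1 z N; rewrite expr1n => ->; congr (_ * _); apply: eq_bigr => i _.
  by rewrite expr1n mul1r.
rewrite -[leRHS]mul1r ler_pdivlMr ?subr_gt0// mulrC E.
by rewrite gerBl exprn_ge0 ?ltW.
Qed.

End BesovBound.

(** * Fourier decay of the symbol and of the functions y_xi *)

Section SymbolEstimate.
Variable R : realType.
Variable n : nat.
Implicit Types (xi eta : 'rV[int]_n).

Lemma Re_iter_sdiff (v : 'rV[R]_n) h k (f : fn R n) x :
  complex.Re (iter k (sdiff v h) f x) = iter k (sdiff v h) (fun y => complex.Re (f y)) x.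
Proof. by elim: k x => [//|k IH] x; rewrite !iterS /sdiff raddfB -!IH. Qed.

Lemma Im_iter_sdiff (v : 'rV[R]_n) h k (f : fn R n) x :
  complex.Im (iter k (sdiff v h) f x) = iter k (sdiff v h) (fun y => complex.Im (f y)) x.
Proof. by elim: k x => [//|k IH] x; rewrite !iterS /sdiff raddfB -!IH. Qed.

Lemma cmeasurable_smooth (f : fn R n) :
  smooth (fun x => complex.Re (f x)) -> smooth (fun x => complex.Im (f x)) -> cmeasurable f.
Proof.
move=> s1 s2; split.
- exact: (continuous_rowofT_measurable (smooth_continuous s1)).
- exact: (continuous_rowofT_measurable (smooth_continuous s2)).
Qed.

Lemma fourier_echarM (f : fn R n) xi eta :
  fourier (fun x => echar xi x * f x) eta = fourier f (eta - xi).
Proof.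
rewrite /fourier; congr Tint; apply/funext => x; rewrite mulrA /echar -cexpiD.
congr (cexpi _ * _); rewrite addrC -mulrBr -mulrN; congr (_ * _).
rewrite /dotZ -sumrB -sumrN; apply: eq_bigr => i _.
by rewrite !mxE intrD rmorphN/= mulrDr mulrN opprD opprK addrC.
Qed.

(** For nonzero [xi] a coordinate of largest modulus satisfies [1 + |xi|^2 <= (n + 1) xi_i^2], and
    the [k]-th power of this meets the decay of even order [2 * k] in that coordinate. For [xi = 0]
    the bracket is 1 and [F <= B] suffices. *)
Lemma coord_decay (k : nat) (F B : R) xi : 0 <= F -> F <= B ->
  (forall i, xi 0 i != 0 -> `|(xi 0 i)%:~R| ^+ (2 * k) * F <= B) ->
  powR (jbr R xi) (2 * k)%:R * F <= (n.+1%:R) ^+ k * B.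
Proof.
move=> F0 FB hB.
rewrite powR_mulrn ?(ltW (jbr_gt0 _ _))// exprM jbr_sqr.
have B0 : 0 <= B by exact: le_trans FB.
case: (pselect (exists i, xi 0 i != 0)) => [[i0 hi0]|none]; last first.
  rewrite big1 => [|i _]; last first.
    by apply/eqP; rewrite sqrf_eq0 intr_eq0; apply/negP => /negP h; apply: none; exists i.
  rewrite addr0 expr1n mul1r; apply: le_trans FB _.
  by rewrite ler_peMl// exprn_ege1// ler1n.
pose i1 := [arg max_(i > i0) `|xi 0 i|]%O.
have hmax i : `|xi 0 i| <= `|xi 0 i1|.
  by rewrite /i1; case: arg_maxP => // j _ h; exact: h.
have nz : xi 0 i1 != 0 by rewrite -normr_gt0; apply: lt_le_trans (hmax i0); rewrite normr_gt0.
set Z : R := ((xi 0 i1)%:~R) ^+ 2.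
have Z1 : 1 <= Z.
  rewrite /Z -rmorphXn /= -[1]/(1%:~R) ler_int -real_normK ?num_real//.
  by rewrite exprn_ege1// -gtz0_ge1 normr_gt0.
have sumZ : 1 + \sum_i ((xi 0 i)%:~R : R) ^+ 2 <= n.+1%:R * Z.
  rewrite -natr1 mulrDl mul1r addrC lerD//.
  apply: (@le_trans _ _ (\sum_(i < n) Z)); last by rewrite sumr_const card_ord mulr_natl.
  apply: ler_sum => i _; rewrite /Z -!rmorphXn /= ler_int.
  rewrite -[leLHS]real_normK ?num_real// -[leRHS]real_normK ?num_real//.
  by rewrite lerXn2r ?nnegrE.
apply: (@le_trans _ _ ((n.+1%:R * Z) ^+ k * F)).
  rewrite ler_wpM2r//; apply: lerXn2r => //; rewrite nnegrE.
    by rewrite addr_ge0// sumr_ge0// => i _; exact: sqr_ge0.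
  by rewrite mulr_ge0// (le_trans ler01 Z1).
rewrite exprMn -mulrA ler_wpM2l ?exprn_ge0//.
have := hB i1 nz; rewrite exprM real_normK ?num_real//.
Qed.

Variables (m rho delta : R) (k : nat) (a : 'rV[R]_n -> 'rV[int]_n -> R[i]).
Hypothesis delta0 : 0 <= delta.
Hypothesis ha : symbol_class m rho delta (2 * k) a.

Lemma symbol_sup : exists2 C : R, 0 <= C & forall x xi, cabs (a x xi) <= C * powR (jbr R xi) m.
Proof.
case: ha => _ [_ /(_ [::] isT)[C hC]].
exists `|C| => // x xi; have := hC x xi; rewrite mulr0 addr0 /Dseq /=.
rewrite (_ : (_ +i* _)%C = a x xi); last by case: (a x xi).
by move=> h; apply: le_trans h _; rewrite ler_wpM2r ?powR_ge0// ler_norm.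
Qed.

Lemma symbol_fourier_decay : exists2 C : R, 0 <= C &
  forall xi eta, cabs (fourier (a ^~ xi) eta) <=
    C * powR (jbr R xi) (m + (2 * k)%:R * delta) * powR (jbr R eta) (- (2 * k)%:R).
Proof.
have [C0 C00 hC0] := symbol_sup.
case: ha => pa [sa ka].
(* The symbol class provides a separate constant for each list of directions; one is chosen here for
   each pure derivative of order [2 * k]. *)
have [D hD] : exists D : 'I_n -> R, forall i x xi,
    cabs ((Dseq (nseq (2 * k) i) (fun y => complex.Re (a y xi)) x) +i*
          (Dseq (nseq (2 * k) i) (fun y => complex.Im (a y xi)) x))%C
      <= D i * powR (jbr R xi) (m + delta * (2 * k)%:R).
  have ka' i : exists C : R, forall x xi,
    cabs ((Dseq (nseq (2 * k) i) (fun y => complex.Re (a y xi)) x) +i*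
          (Dseq (nseq (2 * k) i) (fun y => complex.Im (a y xi)) x))%C
      <= C * powR (jbr R xi) (m + delta * (2 * k)%:R).
    by have := ka (nseq (2 * k) i); rewrite size_nseq => /(_ (leqnn _)).
  by exists (fun i => sval (cid (ka' i))) => i; exact: (svalP (cid (ka' i))).
(* One constant for order zero, which settles [eta = 0], and for the top derivatives in all
   directions. In the witness below, [n.+1%:R ^+ k] comes from [coord_decay], one factor 2 from
   recombining real and imaginary parts, the other from the bound on a Fourier coefficient. *)
pose D1 : R := C0 + \sum_i `|D i|.
have D10 : 0 <= D1 by rewrite addr_ge0// sumr_ge0.
exists (n.+1%:R ^+ k * (2 * (2 * D1))); first by rewrite !mulr_ge0 ?exprn_ge0.
move=> xi eta.
set P := powR (jbr R xi) _.
have PE : powR (jbr R xi) (m + delta * (2 * k)%:R) = P by rewrite /P mulrC.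
have P0 : 0 <= P by exact: powR_ge0.
have mf : cmeasurable (a ^~ xi) by case: (sa xi) => s1 s2; exact: cmeasurable_smooth.
have CP : C0 * powR (jbr R xi) m <= D1 * P.
  apply: ler_pM => //; rewrite ?powR_ge0//.
    by rewrite lerDl sumr_ge0.
  by rewrite /P; apply: ler_powR; rewrite ?jbr_ge1// lerDl mulr_ge0.
have fM x : cabs (a x xi) <= D1 * P by apply: le_trans CP.
rewrite powRN ler_pdivlMr ?powR_gt0 ?jbr_gt0// mulrC -!mulrA [X in _ <= _ * X]mulrA.
rewrite -(mulrA 2).
apply: coord_decay; first exact: cabs_ge0.
  apply: le_trans (cabs_fourier_bounded eta mf fM) _.
  by rewrite ler_pM2l// mulr_natl mulr2n lerDl mulr_ge0.
move=> i etai; apply: (fourier_decay mf fM (pa xi) etai) => h h0 x.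
have DP x' : `|Dseq (nseq (2 * k) i) (fun y => complex.Re (a y xi)) x'| <= D1 * P /\
    `|Dseq (nseq (2 * k) i) (fun y => complex.Im (a y xi)) x'| <= D1 * P.
  have H : D i * powR (jbr R xi) (m + delta * (2 * k)%:R) <= D1 * P.
    rewrite PE ler_wpM2r// /D1 (bigD1 i)//= addrCA.
    apply: le_trans (ler_norm _) _; rewrite lerDl addr_ge0// sumr_ge0//.
  have h1 := le_trans (hD i x' xi) H.
  by split; apply: le_trans h1; [exact: (ler_Re_cabs (_ +i* _)%C)|exact: (ler_Im_cabs (_ +i* _)%C)].
apply: le_trans (ler_cabs_ReIm _) _; rewrite Re_iter_sdiff Im_iter_sdiff.
rewrite mulrCA mulr_natl mulr2n; apply: lerD.
- by apply: iter_sdiff_bound => // [|y]; [case: (sa xi)|case: (DP y)].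
- by apply: iter_sdiff_bound => // [|y]; [case: (sa xi)|case: (DP y)].
Qed.

Definition ysym xi : fn R n := fun x => echar xi x * a x xi.

Lemma cmeasurable_ysym xi : cmeasurable (ysym xi).
Proof.
apply: cmeasurableM; first exact: cmeasurable_echar.
by case: ha => _ [sa _]; case: (sa xi) => s1 s2; exact: cmeasurable_smooth.
Qed.

Lemma periodic_ysym xi : Defs.periodic (ysym xi).
Proof. by case: ha => pa _ x i; rewrite /ysym periodic_echar pa. Qed.

Lemma cabs_ysym xi x : cabs (ysym xi x) = cabs (a x xi).
Proof. by rewrite /ysym cabsM cabs_echar mul1r. Qed.

(** Peetre's inequality moves the weight [<eta>^v] onto [xi] and [eta - xi]; what remains,
    [<eta - xi>^(v - 2k)], is summable with a bound independent of [xi] because [2k - v > n]. *)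
Lemma ysym_fourier_bounded (v : R) : (0 < n)%N -> 0 <= v -> n%:R < (2 * k)%:R - v ->
  exists2 C : R, 0 <= C &
    forall xi, fourier_bounded v (ysym xi) (C * powR (jbr R xi) (v + m + (2 * k)%:R * delta)).
Proof.
move=> n0 v0 nv; have [C C0 hC] := symbol_fourier_decay.
have [K hK] := jbr_sum_bounded n0 nv.
have K0 : 0 <= K by apply: le_trans (hK [::] isT); rewrite big_nil.
exists (powR 2 v * C * K); first by rewrite !mulr_ge0 ?powR_ge0.
move=> xi N.
apply: (@le_trans _ _ (\sum_(eta <- boxseq n N) powR 2 v * C * powR (jbr R xi) (v + m + (2 * k)%:R * delta)
     * powR (jbr R (eta - xi)) (- ((2 * k)%:R - v)))).
  apply: ler_sum => eta _; rewrite fourier_echarM.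
  apply: (@le_trans _ _ (powR (2 * (jbr R xi * jbr R (eta - xi))) v *
     (C * powR (jbr R xi) (m + (2 * k)%:R * delta) * powR (jbr R (eta - xi)) (- (2 * k)%:R)))).
    apply: ler_pM; rewrite ?powR_ge0 ?cabs_ge0//.
    apply: ge0_ler_powR; rewrite ?nnegrE ?mulr_ge0 ?(ltW (jbr_gt0 _ _))//.
    exact: jbr_peetre.
  rewrite !powRM ?mulr_ge0 ?(ltW (jbr_gt0 _ _))// opprB.
  have jx := jbr_gt0 R xi; have je := jbr_gt0 R (eta - xi).
  rewrite -[v + m + _]addrA (powRD (r := v)) ?(gt_eqF jx) ?implybT//.
  rewrite (powRD (x := jbr R (eta - xi))) ?(gt_eqF je) ?implybT//.
  rewrite le_eqVlt; apply/orP; left; apply/eqP.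
  move: (powR 2 v) (powR (jbr R xi) v) (powR (jbr R (eta - xi)) v) (powR (jbr R xi) _) (powR (jbr R (eta - xi)) _).
  by move=> x1 x2 x3 x4 x5; ring.
rewrite -mulr_sumr -!mulrA ler_wpM2l ?powR_ge0// ler_wpM2l// mulrC ler_wpM2r ?powR_ge0//.
(* Translation by [xi] turns the cube into another duplicate-free list, and [K] bounds the sums over
   all of these. *)
rewrite -(big_map (fun eta => eta - xi) predT (fun z => powR (jbr R z) (- ((2 * k)%:R - v)))).
by apply: hK; rewrite map_inj_uniq ?boxseq_uniq// => x y /addIr.
Qed.

End SymbolEstimate.

(** * The nuclear decomposition *)

Section Nuclear.
Variable R : realType.
Variable n : nat.

Lemma clinear_fourier (E : set (fn R n)) xi :
  (forall u, E u -> torus_integrable u) -> clinear_on E (fun u => fourier u xi).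
Proof. by move=> hE u v al be /hE hu /hE hv; exact: fourier_linear. Qed.

Lemma clinear_zero (E : set (fn R n)) : clinear_on E (fun _ => 0).
Proof. by move=> u v al be _ _; rewrite !mulr0 addr0. Qed.

Variables (m rho delta : R) (k : nat) (a : 'rV[R]_n -> 'rV[int]_n -> R[i]).
Variables (r w2 : R) (p2 q2 : \bar R).
Hypothesis n0 : (0 < n)%N.
Hypothesis r01 : 0 < r <= 1.
Hypothesis delta01 : 0 <= delta <= 1.
Hypothesis ha : symbol_class m rho delta (2 * k) a.
Hypothesis hw2 : 0 <= w2 < (2 * k)%:R - n%:R.
Hypothesis hm : m < - (n%:R / r) - w2 - 2 * k%:R * delta.
Hypothesis p21 : (1 <= p2)%E.
Hypothesis q21 : (1 <= q2)%E.

(** [e1] and [e2] are the slack in the strict bounds on [w2] and [m]; half of the smaller one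
    preserves both. *)
Lemma exponent_margin : exists2 eps : R, 0 < eps &
  n%:R < (2 * k)%:R - (w2 + eps) /\
  n%:R / r < - (w2 + eps + m + (2 * k)%:R * delta).
Proof.
case/andP: hw2 => w20 w2k.
pose e1 : R := (2 * k)%:R - n%:R - w2.
pose e2 : R := - (n%:R / r) - w2 - 2 * k%:R * delta - m.
have e10 : 0 < e1 by rewrite /e1; lra.
have e20 : 0 < e2 by rewrite /e2 subr_gt0.
exists (Num.min e1 e2 / 2); first by rewrite divr_gt0// lt_min e10.
have m1 : Num.min e1 e2 <= e1 by rewrite ge_min lexx.
have m2 : Num.min e1 e2 <= e2 by rewrite ge_min lexx orbT.
have mp : 0 < Num.min e1 e2 by rewrite lt_min e10.
move: m1 m2 mp; move: (Num.min e1 e2) => mm; rewrite /e1 /e2 natrM.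
move: (n%:R / r) (2 * k%:R * delta) => x y m1 m2 mp; split; lra.
Qed.

Variables (eps tau : R).
Hypothesis eps0 : 0 < eps.
Hypothesis eps2k : n%:R < (2 * k)%:R - (w2 + eps).
Hypothesis tauE : tau = - (w2 + eps + m + (2 * k)%:R * delta).
Hypothesis ntau : n%:R / r < tau.

(** Up to a constant, one weight dominates both the sup norm and the weighted Fourier norm of
    [ysym a xi]. *)
Let W (xi : 'rV[int]_n) : R := powR (jbr R xi) (- tau).

(** The role of [r <= 1]: since [n <= n / r], the weights themselves are summable and not only their
    [r]-th powers, so the series for [Top a u] converges absolutely. *)
Let n_tau : n%:R < tau.
Proof.
apply: le_lt_trans ntau; case/andP: r01 => r0 r1.
by rewrite ler_pdivlMr// ler_piMr.
Qed.

Let W0 xi : 0 <= W xi. Proof. exact: powR_ge0. Qed.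

Lemma weight_bounded : exists K, forall A : seq 'rV[int]_n, uniq A -> \sum_(xi <- A) W xi <= K.
Proof. exact: (jbr_sum_bounded n0 n_tau). Qed.

Lemma ysym_bounds : exists2 C : R, 0 <= C & forall xi,
  (forall x, cabs (ysym a xi x) <= C * W xi) /\
  fourier_bounded (w2 + eps) (ysym a xi) (C * W xi).
Proof.
case/andP: delta01 => d0 d1; case/andP: hw2 => w20 _.
have [C1 C10 h1] := symbol_sup ha.
have [C2 C20 h2] := ysym_fourier_bounded d0 ha n0 (addr_ge0 w20 (ltW eps0)) eps2k.
exists (C1 + C2); first exact: addr_ge0.
move=> xi; split.
  move=> x; rewrite cabs_ysym; apply: le_trans (h1 x xi) _.
  apply: ler_pM; rewrite ?powR_ge0 ?lerDl//; apply: ler_powR; first exact: jbr_ge1.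
  (* The exponent of [W] exceeds [m] by [w2 + eps + 2k delta >= 0], which absorbs the sup bound on
     the symbol. *)
  rewrite tauE opprK -[leLHS]addr0 -addrA [w2 + eps + _]addrC -addrA lerD2l.
  by rewrite addr_ge0 ?mulr_ge0// addr_ge0// ltW.
move=> N; apply: le_trans (h2 xi N) _; rewrite /W tauE opprK.
by rewrite ler_wpM2r ?powR_ge0// lerDr.
Qed.

Section Remainder.
Variables (u : fn R n) (M : R).
Hypothesis uM : forall xi, cabs (fourier u xi) <= M.

Let M0 : 0 <= M. Proof. exact: le_trans (cabs_ge0 _) (uM 0). Qed.

Let term (xi : 'rV[int]_n) (x : 'rV[R]_n) : R[i] := fourier u xi * ysym a xi x.

Definition remainder N : fn R n := fun x => Top a u x - \sum_(xi <- zseq n N) term xi x.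

Lemma Tpart_box N x : Tpart a u N x = \sum_(xi <- boxseq n N) term xi x.
Proof.
by rewrite big_boxseq; apply: eq_bigr => j _; rewrite /term /ysym mulrC.
Qed.

(** [Top] is written with [limn], which says nothing until the limits are known to exist. Domination
    of the terms by [M * C * W xi], uniform in [x], supplies both the limits and the rate. *)
Lemma Tpart_cvg : exists2 C, 0 <= C & forall x,
  [/\ (fun N => complex.Re (Tpart a u N x)) @ \oo --> complex.Re (Top a u x),
      (fun N => complex.Im (Tpart a u N x)) @ \oo --> complex.Im (Top a u x) &
      forall N, cabs (remainder N x) <= C * ztail W N].
Proof.
have [K hK] := weight_bounded.
have [C C0 hC] := ysym_bounds.
have CM0 : 0 <= M * C by exact: mulr_ge0.
have tb x xi : cabs (term xi x) <= M * C * W xi.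
  rewrite /term cabsM -mulrA; apply: ler_pM; rewrite ?cabs_ge0//.
  by case: (hC xi) => h _; exact: h.
exists (2 * (M * C)); first exact: mulr_ge0.
move=> x.
have [l1 [c1 t1]] := box_sum_lim W0 hK CM0 (fun xi => le_trans (ler_Re_cabs (term xi x)) (tb x xi)).
have [l2 [c2 t2]] := box_sum_lim W0 hK CM0 (fun xi => le_trans (ler_Im_cabs (term xi x)) (tb x xi)).
have E1 : (fun N => complex.Re (Tpart a u N x)) = (fun N => \sum_(xi <- boxseq n N) complex.Re (term xi x)).
  by apply/funext => N; rewrite Tpart_box Re_sum.
have E2 : (fun N => complex.Im (Tpart a u N x)) = (fun N => \sum_(xi <- boxseq n N) complex.Im (term xi x)).
  by apply/funext => N; rewrite Tpart_box Im_sum.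
have T1 : complex.Re (Top a u x) = l1 by rewrite /Top /= E1; exact/cvg_lim.
have T2 : complex.Im (Top a u x) = l2 by rewrite /Top /= E2; exact/cvg_lim.
split; [by rewrite E1 T1 | by rewrite E2 T2 |].
move=> N; apply: le_trans (ler_cabs_ReIm _) _.
rewrite /remainder ReB ImB Re_sum Im_sum T1 T2 -mulrA mulr_natl mulr2n.
exact: lerD.
Qed.

Lemma cmeasurable_term xi : cmeasurable (term xi).
Proof.
by apply: cmeasurableM; [exact: cmeasurable_cst|exact: (cmeasurable_ysym ha)].
Qed.

Lemma periodic_term xi : Defs.periodic (term xi).
Proof. by move=> x i; rewrite /term (periodic_ysym ha). Qed.

Lemma cmeasurable_Top : cmeasurable (Top a u).
Proof.
have [C _ hC] := Tpart_cvg.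
have mT N : cmeasurable (Tpart a u N).
  rewrite (_ : Tpart a u N = fun x => \sum_(xi <- boxseq n N) term xi x).
    by apply: cmeasurable_sum => xi; exact: cmeasurable_term.
  by apply/funext => x; exact: Tpart_box.
split.
- apply: (measurable_fun_cvg (h := fun N t => complex.Re (Tpart a u N (rowofT t)))).
    by move=> N; case: (mT N).
  by move=> t _; case: (hC (rowofT t)).
- apply: (measurable_fun_cvg (h := fun N t => complex.Im (Tpart a u N (rowofT t)))).
    by move=> N; case: (mT N).
  by move=> t _; case: (hC (rowofT t)).
Qed.

Lemma periodic_Top : Defs.periodic (Top a u).
Proof.
move=> x i.
have E N : Tpart a u N (x + delta_mx 0 i) = Tpart a u N x.
  by rewrite !Tpart_box; apply: eq_bigr => xi _; rewrite periodic_term.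
by rewrite /Top; congr (_ +i* _)%C; congr (limn _); apply/funext => N; rewrite E.
Qed.

Lemma cmeasurable_remainder N : cmeasurable (remainder N).
Proof.
rewrite /remainder; under eq_fun do rewrite -mulN1r.
apply: cmeasurableD; first exact: cmeasurable_Top.
apply: cmeasurableM; first exact: cmeasurable_cst.
by apply: cmeasurable_sum => xi; exact: cmeasurable_term.
Qed.

(** The coefficients ought to be sums over the points not yet enumerated, but proving so would
    exchange an infinite sum with an integral. Instead [d] terms are split off by linearity, and the
    coefficients of [remainder (N + d)] are bounded through its sup norm; for a fixed cube this
    error vanishes as [d] grows. *)
Lemma remainder_fourier_bounded : exists2 C : R, 0 <= C &
  forall N, fourier_bounded (w2 + eps) (remainder N) (C * ztail W N).
Proof.
have [K hK] := weight_bounded.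
have [C C0 hC] := ysym_bounds.
have [D D0 hD] := Tpart_cvg.
exists (M * C); first exact: mulr_ge0.
move=> N N'.
have bt xi : torus_integrable (ysym a xi).
  by case: (hC xi) => h _; apply: (torus_integrable_bounded (cmeasurable_ysym ha xi) h).
have br L : torus_integrable (remainder L).
  by apply: (torus_integrable_bounded (cmeasurable_remainder L)) => x; case: (hD x) => _ _; exact.
have step L eta : fourier (remainder L) eta =
    zterm (fun xi => fourier u xi * fourier (ysym a xi) eta) L + fourier (remainder L.+1) eta.
  (* The enumeration gains one point at index [L] or, at a gap, none, and then the two remainders
     coincide. *)
  have zE : zseq n L.+1 = zseq n L ++ (if @pickle_inv 'rV[int]_n L is Some xi then [:: xi] else [::]).
    rewrite /zseq -(addn1 L) iotaD pmap_cat add0n /=; by case: pickle_inv.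
  rewrite /zterm; case E : (pickle_inv L) zE => [xi|] /= zE; last first.
    by rewrite add0r /remainder zE cats0.
  rewrite -[fourier (remainder L.+1) eta]mul1r -fourier_linear//.
  congr fourier; apply/funext => x.
  by rewrite /remainder zE big_cat big_seq1/= mul1r [RHS]addrC -/(term xi x) opprD addrA subrK.
have steps d eta : cabs (fourier (remainder N) eta) <=
    \sum_(N <= j < N + d) zterm (fun xi => M * cabs (fourier (ysym a xi) eta)) j
    + cabs (fourier (remainder (N + d)) eta).
  elim: d => [|d IH]; first by rewrite addn0 big_geq// add0r.
  rewrite addnS big_nat_recr ?leq_addr//= -addrA; apply: le_trans IH _; rewrite lerD2l.
  rewrite step; apply: le_trans (ler_cabsD _ _) _; rewrite lerD2r /zterm.
  by case: pickle_inv => [xi|] /=; rewrite ?cabs0// cabsM ler_wpM2r ?cabs_ge0.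
(* [Q] depends on the cube [N'] but not on [d], so it disappears in the limit over [d]. *)
pose Q : R := \sum_(eta <- boxseq n N') powR (jbr R eta) (w2 + eps).
have Q0 : 0 <= Q by apply: sumr_ge0 => eta _; exact: powR_ge0.
have main d : \sum_(eta <- boxseq n N') powR (jbr R eta) (w2 + eps) * cabs (fourier (remainder N) eta)
   <= M * C * ztail W N + Q * (2 * (D * ztail W (N + d))).
  apply: (@le_trans _ _ (\sum_(eta <- boxseq n N') powR (jbr R eta) (w2 + eps) *
     (\sum_(N <= j < N + d) zterm (fun xi => M * cabs (fourier (ysym a xi) eta)) j
      + 2 * (D * ztail W (N + d))))).
    apply: ler_sum => eta _; rewrite ler_wpM2l ?powR_ge0//; apply: le_trans (steps d eta) _.
    rewrite lerD2l; apply: cabs_fourier_bounded; first exact: cmeasurable_remainder.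
    by move=> x; case: (hD x) => _ _; exact.
  under eq_bigr do rewrite mulrDr.
  rewrite big_split/= -mulr_suml lerD2r.
  under eq_bigr do rewrite mulr_sumr.
  rewrite exchange_big/=.
  apply: (@le_trans _ _ (\sum_(N <= j < N + d) M * C * zterm W j)).
    apply: ler_sum => j _; rewrite /zterm; case: pickle_inv => [xi|] /=; last first.
      by rewrite mulr0 big1// => eta _; rewrite mulr0.
    under eq_bigr do rewrite mulrCA.
    rewrite -mulr_sumr -mulrA ler_wpM2l//.
    by case: (hC xi) => _; exact.
  rewrite -mulr_sumr ler_wpM2l ?mulr_ge0//.
  rewrite /ztail lerBrDl.
  rewrite -(big_mkord predT (zterm W)) -big_cat_nat ?leq_addr//= big_mkord.
  apply: (nondecreasing_cvgn_le (u_ := fun L => \sum_(j < L) zterm W j)).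
    by apply/nondecreasing_seqP => L; rewrite big_ord_recr lerDl zterm_ge0.
  exact: (zsum_cvg W0 hK).
have cl : (fun d => M * C * ztail W N + Q * (2 * (D * ztail W (N + d)))) @ \oo --> M * C * ztail W N.
  rewrite -[X in _ --> X]addr0; apply: cvgD; first exact: cvg_cst.
  rewrite -(mulr0 Q) -(mulr0 2) -(mulr0 D); do 3!apply: cvgMr.
  have := ztail_cvg0 W0 hK; rewrite -(cvg_shiftn N).
  by under eq_fun do rewrite addnC.
by apply: (cvgr_to_ge cl); apply: nearW.
Qed.

End Remainder.

Lemma mem_besov_space (f : fn R n) (M S : R) : Defs.periodic f -> cmeasurable f ->
  (forall x, cabs (f x) <= M) -> fourier_bounded (w2 + eps) f S ->
  besov_space w2 p2 q2 f.
Proof.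
move=> pf mf fM fS; case/andP: hw2 => w20 _.
split => //; split => //; split.
  by apply: le_lt_trans (Lpnorm_bounded _ mf fM) (ltry _).
have [C C0 hC] := besov_le n w20 eps0 p21 q21.
exact: le_lt_trans (hC f S fS) (ltry _).
Qed.

Lemma fourier_bounded0 v : fourier_bounded v (fun _ : 'rV[R]_n => 0) 0.
Proof.
move=> N; rewrite big1// => xi _.
apply/eqP; rewrite mulf_eq0; apply/orP; right; rewrite eq_le cabs_ge0 andbT.
rewrite -[leRHS](mulr0 2); apply: cabs_fourier_bounded; first exact: cmeasurable_cst.
by move=> x; rewrite cabs0.
Qed.

Lemma besov_zero : besov w2 p2 q2 (fun _ : 'rV[R]_n => 0) = 0%E.
Proof.
case/andP: hw2 => w20 _; apply/eqP; rewrite eq_le besov_ge0 andbT.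
have [C C0 hC] := besov_le n w20 eps0 p21 q21.
by have := hC _ _ (@fourier_bounded0 (w2 + eps)); rewrite mulr0.
Qed.

(** The zero function in the unit ball keeps the supremum from running over the empty set, where it
    would be [-oo]. *)
Lemma dual_norm_ge0 (E : set (fn R n)) NE e : E (fun _ => 0) -> (NE (fun _ => 0%R) <= 1)%E ->
  (0 <= dual_norm E NE e)%E.
Proof.
move=> E0 NE0; apply: le_trans (ereal_sup_ubound _); last by exists (fun _ => 0).
by rewrite lee_fin cabs_ge0.
Qed.

Lemma dual_norm_zero (E : set (fn R n)) NE : E (fun _ => 0) -> (NE (fun _ => 0%R) <= 1)%E ->
  dual_norm E NE (fun _ => 0) = 0%E.
Proof.
move=> E0 NE0; apply/eqP; rewrite eq_le dual_norm_ge0// andbT.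
by apply: ge_ereal_sup => _ [u _ <-]; rewrite cabs0.
Qed.

Lemma dual_norm_fourier (E : set (fn R n)) NE (B : R) xi :
  (forall u, E u -> torus_integrable u) ->
  (forall u, E u -> (NE u <= 1)%E -> (cubeintE (fun t => (cabs (u (rowofT t)))%:E) <= B%:E)%E) ->
  (dual_norm E NE (fun u => fourier u xi) <= (2 * B)%:E)%E.
Proof.
move=> hE hN; apply: ge_ereal_sup => _ [u [Eu Nu] <-]; rewrite lee_fin.
by apply: cabs_fourier; [case: (hE u Eu)|exact: hN].
Qed.

Lemma r_nuclear_of_integrable (E : set (fn R n)) NE (B : R) :
  (forall u, E u -> torus_integrable u) ->
  (forall u, E u -> (NE u <= 1)%E -> (cubeintE (fun t => (cabs (u (rowofT t)))%:E) <= B%:E)%E) ->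
  E (fun _ => 0) -> (NE (fun _ => 0%R) <= 1)%E ->
  r_nuclear r E NE (besov_space w2 p2 q2) (besov w2 p2 q2) (Top a).
Proof.
move=> hE hN E0 NE0.
case/andP: hw2 => w20 _; case/andP: r01 => r0 r1.
have B0 : 0 <= B.
  have := hN _ E0 NE0; rewrite -lee_fin; apply: le_trans; apply: cubeintE_ge0 => t.
  by rewrite lee_fin cabs_ge0.
have [C C0 hC] := ysym_bounds.
have [K hK] := weight_bounded.
have [D D0 hD] := @besov_le R n w2 eps p2 q2 w20 eps0 p21 q21.
have coefs u : E u -> exists M, forall xi, cabs (fourier u xi) <= M.
  move=> /hE[mu_ iu].
  have fu : (cubeintE (fun t => (cabs (u (rowofT t)))%:E) \is a fin_num)%E.
    by rewrite ge0_fin_numE//; apply: cubeintE_ge0 => t; rewrite lee_fin cabs_ge0.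
  exists (2 * fine (cubeintE (fun t => (cabs (u (rowofT t)))%:E))) => xi.
  by apply: cabs_fourier => //; rewrite fineK.
(* With nothing subtracted, the remainder estimates also give the membership of [Top a u] in the
   Besov space. *)
have rem0 u : remainder u 0 = Top a u.
  by apply/funext => x; rewrite /remainder big_nil subr0.
split.
  move=> u Eu; have [M uM] := coefs u Eu.
  have [C' _ hC'] := Tpart_cvg uM.
  have [C'' _ hC''] := remainder_fourier_bounded uM.
  apply: (@mem_besov_space _ (C' * ztail W 0) (C'' * ztail W 0)).
  - exact: periodic_Top.
  - exact: (cmeasurable_Top uM).
  - by move=> x; rewrite -rem0; case: (hC' x) => _ _; exact.
  - by rewrite -rem0; exact: hC''.
(* At a gap of the enumeration the functional, the function and the majorant [z j] are all zero. *)
pose e (j : nat) (u : fn R n) : R[i] := zterm (fun xi => fourier u xi) j.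
pose y (j : nat) : fn R n := fun x => zterm (fun xi => ysym a xi x) j.
pose z j : R := zterm (fun xi : 'rV[int]_n => powR (jbr R xi) (- (tau * r))) j.
have ey j : (exists xi, z j = powR (jbr R xi) (- (tau * r)) /\
    e j = (fun u => fourier u xi) /\ y j = ysym a xi) \/
    (z j = 0 /\ e j = (fun _ => 0) /\ y j = (fun _ => 0)).
  rewrite /z /e /y /zterm; case: (pickle_inv j) => [xi|] /=; last by right.
  by left; exists xi.
exists e, y; split; [|split; [|split]].
- move=> j; have [[xi [_ [-> _]]]|[_ [-> _]]] := ey j.
    split; first exact: clinear_fourier.
    exact: le_lt_trans (dual_norm_fourier xi hE hN) (ltry _).
  split; first exact: clinear_zero.
  by rewrite dual_norm_zero// ltry.
- move=> j; have [[xi [_ [_ ->]]]|[_ [_ ->]]] := ey j.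
    case: (hC xi) => h1 h2; apply: (mem_besov_space _ _ h1 h2).
      exact: (periodic_ysym ha).
    exact: (cmeasurable_ysym ha).
  apply: (@mem_besov_space _ 0 0).
  + by [].
  + exact: cmeasurable_cst.
  + by move=> x; rewrite cabs0.
  + exact: fourier_bounded0.
- have ntr : n%:R < tau * r by rewrite -ltr_pdivrMr.
  have [K' hK'] := jbr_sum_bounded n0 ntr.
  (* [2 * B] bounds the dual norms, and [D * C] the Besov norms up to the weight. *)
  pose Q : R := powR (2 * B * (D * C)) r.
  have Q0 : 0 <= Q by exact: powR_ge0.
  have term_le j : ((dual_norm E NE (e j) * besov w2 p2 q2 (y j)) `^ r <=
      (Q * z j)%:E)%E.
    have [[xi [-> [-> ->]]]|[-> [-> ->]]] := ey j; last first.
      (* A gap contributes [0 ^ r], which vanishes because [r] is nonzero. *)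
      by rewrite besov_zero mule0 poweR0r ?gt_eqF// mulr0.
    have -> : (Q * powR (jbr R xi) (- (tau * r)))%:E = ((2 * B * (D * (C * W xi)))%:E `^ r)%E.
      rewrite poweR_EFin [D * _]mulrA [2 * B * _]mulrA powRM ?powR_ge0 ?mulr_ge0//.
      by rewrite /W -powRrM mulNr.
    apply: gt0_ler_poweR; rewrite ?(ltW r0)//.
    + by rewrite in_itv/= leey andbT mule_ge0 ?besov_ge0 ?dual_norm_ge0.
    + by rewrite in_itv/= leey andbT lee_fin !mulr_ge0 ?powR_ge0.
    + rewrite EFinM; apply: lee_pmul; rewrite ?besov_ge0 ?dual_norm_ge0//.
        exact: dual_norm_fourier.
      by apply: hD; case: (hC xi).
  apply: (@le_lt_trans _ _ (Q * K')%:E); last exact: ltry.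
  apply: lime_le.
    by apply: is_cvg_nneseries => j _ _; exact: poweR_ge0.
  apply: nearW => N.
  apply: (le_trans (lee_sum _ (fun j _ => term_le j))).
  rewrite sumEFin lee_fin -mulr_sumr ler_wpM2l// big_mkord /z sum_zterm.
  by apply: hK'; exact: zseq_uniq.
- move=> u Eu; have [M uM] := coefs u Eu.
  have [C' C'0 hC'] := remainder_fourier_bounded uM.
  have remE N : (fun x => Top a u x - \sum_(j < N) e j u * y j x) = remainder u N.
    apply/funext => x; rewrite /remainder -sum_zterm; congr (_ - _).
    apply: eq_bigr => j _; rewrite /e /y /zterm.
    by case: (pickle_inv j) => [xi|] //=; rewrite mul0r.
  apply: (@squeeze_cvge _ _ _ _ (fun=> 0%E) _ (fun N => (D * (C' * ztail W N))%:E)).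
  + by apply: nearW => N; rewrite remE besov_ge0/=; exact: hD.
  + exact: cvg_cst.
  + apply: cvg_EFin; first exact: nearW.
    have h : (fun N => D * (C' * ztail W N)) @ \oo --> (0 : R).
      have -> : (0 : R) = D * (C' * 0) by rewrite !mulr0.
      by apply: cvgMr; apply: cvgMr; exact: (ztail_cvg0 W0 hK).
    exact: h.
Qed.

End Nuclear.

(** * Lebesgue spaces as domain *)

Section LpSpace.
Variables (R : realType) (n : nat) (p : R).
Hypothesis p1 : 1 <= p.

Let p0 : 0 < p. Proof. exact: lt_le_trans p1. Qed.

(* In place of Hoelder's inequality: [c <= 1 + c ^ p] for [0 <= c] and [1 <= p]. *)
Lemma cubeintE_le_Lp (u : fn R n) : cmeasurable u ->
  (cubeintE (fun t => (cabs (u (rowofT t)))%:E) <=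
   1 + cubeintE (fun t => ((cabs (u (rowofT t)))%:E `^ p)%E))%E.
Proof.
move=> mu_; have mc := measurable_cabs mu_.
have mp : measurable_fun setT (fun t : n.-tuple R => ((cabs (u (rowofT t)))%:E `^ p)%E).
  apply/measurable_EFinP; apply: (measurableT_comp (f := fun x : R => powR x p)) => //.
rewrite -{1}(cubeintE_cst (R := R) n 1%E) -cubeintED//; last by move=> t; exact: poweR_ge0.
apply: le_cubeintE => //.
- exact/measurable_EFinP.
- by apply: emeasurable_funD => //; exact: measurable_cst.
- by move=> t; rewrite lee_fin cabs_ge0.
- move=> t /=; rewrite -EFinD lee_fin; set c := cabs _.
  have c0 : 0 <= c by exact: cabs_ge0.
  have [c1|c1] := leP c 1; first by apply: le_trans c1 _; rewrite lerDl powR_ge0.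
  by apply: le_trans (le1r_powR (ltW c1) p1) _; rewrite lerDr.
Qed.

Lemma Lp_space_integrable (u : fn R n) : Lp_space p u -> torus_integrable u.
Proof.
move=> [_ [mu_ fu]]; split => //; apply: le_lt_trans (cubeintE_le_Lp mu_) _.
rewrite lte_add_pinfty ?ltry//; apply: lty_poweRy fu.
by rewrite invr_eq0 gt_eqF.
Qed.

Lemma Lp_unit_ball (u : fn R n) : Lp_space p u -> (Lpnorm p%:E u <= 1)%E ->
  (cubeintE (fun t => (cabs (u (rowofT t)))%:E) <= 2%:E)%E.
Proof.
move=> [_ [mu_ _]] u1; apply: le_trans (cubeintE_le_Lp mu_) _.
rewrite (_ : 2%:E = 1 + 1)%E//; apply: leeD => //.
set X := cubeintE _ in u1 *.
have X0 : (0 <= X)%E by apply: cubeintE_ge0 => t; exact: poweR_ge0.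
have := gt0_ler_poweR (ltW p0) _ _ u1; rewrite !in_itv/= !leey !andbT poweR_ge0 lee01.
by move=> /(_ isT isT); rewrite -poweRrM mulVf ?gt_eqF// poweRe1// powR1.
Qed.

Lemma Lp_space0 : @Lp_space R n p (fun _ => 0) /\ (Lpnorm p%:E (fun _ : 'rV[R]_n => 0%R) <= 1)%E.
Proof.
have N0 : Lpnorm p%:E (fun _ : 'rV[R]_n => 0%R) = 0%E.
  rewrite /Lpnorm [X in cubeintE X](_ : _ = fun=> 0%E); last first.
    by apply/funext => t; rewrite cabs0 poweR0r// gt_eqF.
  by rewrite cubeintE_cst poweR0r// invr_eq0 gt_eqF.
have h1 : (Lpnorm p%:E (fun _ : 'rV[R]_n => 0%R) <= 1)%E by rewrite N0.
split; last exact: h1.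
split => //; split; first exact: cmeasurable_cst.
exact: le_lt_trans h1 (ltry _).
Qed.

End LpSpace.

(** * The Hölder space as domain *)

Section HolderSpace.
Variables (R : realType) (s : R).
Hypothesis s0 : 0 < s.

(** A supremum over the empty set would be [-oo]; the increment [h = 1] shows that quotients
    exist. *)
Lemma holder_normE_ge0 (u : fn R 1) :
  (0 <= ereal_sup [set e | exists (x h : 'rV[R]_1), h != 0%R /\
      e = ((cabs (u (x + h) - u x)) / powR (Num.sqrt (\sum_i (h 0 i) ^+ 2)) s)%:E])%E.
Proof.
set S := [set e | _].
pose h1 : 'rV[R]_1 := const_mx 1.
have : S ((cabs (u (0 + h1) - u 0)) / powR (Num.sqrt (\sum_i (h1 0 i) ^+ 2)) s)%:E.
  exists 0, h1; split => //; apply/eqP => /rowP /(_ 0); rewrite !mxE => /eqP.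
  by rewrite oner_eq0.
move=> h; apply: le_trans (ereal_sup_ubound h); rewrite lee_fin.
by rewrite divr_ge0 ?cabs_ge0 ?powR_ge0.
Qed.

Lemma holder_sup_le (u : fn R 1) (M : \bar R) : (holder_norm s u <= M)%E ->
  forall x, ((cabs (u x))%:E <= M)%E.
Proof.
move=> hM x; apply: le_trans hM; rewrite /holder_norm -[leLHS]add0e.
apply: leeD; first exact: holder_normE_ge0.
by apply: ereal_sup_ubound; exists x.
Qed.

Lemma holder_bounded (u : fn R 1) : holder_space s u -> exists M : R, forall x, cabs (u x) <= M.
Proof.
move=> [_]; have := holder_sup_le (lexx (holder_norm s u)).
case: (holder_norm s u) => [M h _|//|h _].
  by exists M => x; rewrite -lee_fin.
by have := h 0.
Qed.

Lemma holder_modulus (u : fn R 1) : holder_space s u -> exists2 A : R, 0 <= A &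
  forall x y : 'rV[R]_1, cabs (u y - u x) <= A * powR `|y 0 0 - x 0 0| s.
Proof.
move=> [_ hu].
have A0 := holder_normE_ge0 u; move: hu; rewrite /holder_norm.
set S := [set e | _] in A0 *; set T := ereal_sup _ in A0 *; set B := ereal_sup _ => hu.
have B0 : (0 <= B)%E.
  by apply: le_trans (ereal_sup_ubound _); last (by exists 0); rewrite lee_fin cabs_ge0.
have Tfin : T \is a fin_num.
  by rewrite ge0_fin_numE//; apply: le_lt_trans hu; rewrite leeDl.
exists (fine T); first exact: fine_ge0.
move=> x y; have [->|xy] := eqVneq y x.
  by rewrite subrr cabs0 mulr_ge0 ?fine_ge0 ?powR_ge0.
have d0 : y 0 0 - x 0 0 != 0.
  apply: contra_neq xy => /eqP; rewrite subr_eq0 => /eqP E.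
  by apply/rowP => i; rewrite (ord1 i) E.
rewrite -ler_pdivrMr ?powR_gt0 ?normr_gt0//.
rewrite -lee_fin fineK//; apply: ereal_sup_ubound.
exists x, (y - x); split; first by rewrite subr_eq0.
rewrite (_ : x + (y - x) = y); last by rewrite addrC subrK.
by rewrite big_ord1 sqrtr_sqr !mxE.
Qed.

Lemma ball_continuous n (g : 'rV[R]_n -> R) :
  (forall x e, 0 < e -> exists2 d, 0 < d & forall y, ball x d y -> `|g x - g y| < e) ->
  continuous g.
Proof.
move=> hg x A /nbhs_ballP[e /= e0 eA]; have [d d0 hd] := hg x e e0.
by apply/nbhs_ballP; exists d => //= y xy; apply: eA; exact: hd.
Qed.

(** [holder_space] contains no measurability condition: it follows from the continuity of the real
    and imaginary parts. *)
Lemma holder_cmeasurable (u : fn R 1) : holder_space s u -> cmeasurable u.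
Proof.
move=> /holder_modulus[A A0 hA].
have cont (g : 'rV[R]_1 -> R) : (forall x y, `|g x - g y| <= cabs (u y - u x)) -> continuous g.
  move=> hg; apply: ball_continuous => x e e0.
  have A1 : 0 < A + 1 by rewrite ltr_wpDl.
  (* [d] solves [(A + 1) * d^s = e]; the added 1 covers [A = 0] and makes the final inequality
     strict. *)
  pose d := powR (e / (A + 1)) s^-1.
  have d0 : 0 < d by rewrite powR_gt0// divr_gt0.
  exists d => // y [_ xy].
  apply: le_lt_trans (hg x y) _; apply: le_lt_trans (hA x y) _.
  have xyd : `|y 0 0 - x 0 0| < d by rewrite distrC; exact: xy.
  have : powR `|y 0 0 - x 0 0| s < powR d s by apply: gt0_ltr_powR; rewrite ?nnegrE ?(ltW d0).
  rewrite /d -powRrM mulVf ?gt_eqF// powRr1 ?divr_ge0 ?(ltW e0) ?(ltW A1)// => h.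
  have {}h := ltW h; apply: (@le_lt_trans _ _ (A * (e / (A + 1)))); first exact: ler_wpM2l.
  by rewrite mulrA ltr_pdivrMr// [ltLHS]mulrC ltr_pM2l// ltrDl.
split; apply: (continuous_rowofT_measurable (g := fun x => _ (u x))); apply: cont => x y.
- by rewrite distrC -ReB ler_Re_cabs.
- by rewrite distrC -ImB ler_Im_cabs.
Qed.

Lemma holder_integrable (u : fn R 1) : holder_space s u -> torus_integrable u.
Proof.
move=> hu; have [M hM] := holder_bounded hu.
exact: torus_integrable_bounded (holder_cmeasurable hu) hM.
Qed.

Lemma holder_unit_ball (u : fn R 1) : holder_space s u -> (holder_norm s u <= 1)%E ->
  (cubeintE (fun t => (cabs (u (rowofT t)))%:E) <= 1%:E)%E.
Proof.
move=> hu u1; apply: cubeintE_cabs_bounded; first exact: holder_cmeasurable.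
by move=> x; rewrite -lee_fin; exact: holder_sup_le u1 x.
Qed.

Lemma holder_space0 : @holder_space R 1 s (fun _ => 0) /\
  (holder_norm s (fun _ : 'rV[R]_1 => 0%R) <= 1)%E.
Proof.
have N0 : (holder_norm s (fun _ : 'rV[R]_1 => 0%R) <= 0)%E.
  rewrite /holder_norm -[leRHS]adde0; apply: leeD.
    by apply: ge_ereal_sup => _ [x [h [_ ->]]]; rewrite subrr cabs0 mul0r.
  by apply: ge_ereal_sup => _ [x _ <-]; rewrite cabs0.
split; last by apply: le_trans N0 _; rewrite lee_fin.
by split => //; apply: le_lt_trans N0 (ltry _).
Qed.

End HolderSpace.

Theorem theorem3p6 (R : realType) (n : nat) (r rho delta : R) (k : nat) (m : R)
    (a : 'rV[R]_n -> 'rV[int]_n -> R[i]) (w2 : R) (p2 q2 : \bar R) :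
  (0 < n)%N ->
  0 < r <= 1 ->
  0 <= rho <= 1 -> 0 <= delta <= 1 ->
  (n < 2 * k)%N ->
  symbol_class m rho delta (2 * k) a ->
  0 <= w2 < (2 * k)%:R - n%:R ->
  m < - (n%:R / r) - w2 - 2 * k%:R * delta ->
  (1 <= p2)%E -> (1 <= q2)%E ->
  (forall p : R, 1 <= p <= 2 ->
     r_nuclear r (@Lp_space R n p) (Lpnorm p%:E)
       (@besov_space R n w2 p2 q2) (besov w2 p2 q2) (Top a)) /\
  (n = 1%N -> forall s : R, 0 < s < 1 ->
     r_nuclear r (@holder_space R n s) (holder_norm s)
       (@besov_space R n w2 p2 q2) (besov w2 p2 q2) (Top a)).
Proof.
move=> n0 r01 _ delta01 _ ha hw2 hm p21 q21.
have [eps eps0 [epsk epsr]] := exponent_margin hw2 hm.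
split=> [p /andP[p1 _]|n1 s /andP[s0 _]].
  have [L0 L1] := Lp_space0 n p1.
  exact: (r_nuclear_of_integrable n0 r01 delta01 ha hw2 p21 q21 eps0 epsk erefl epsr
    (@Lp_space_integrable R n p p1) (@Lp_unit_ball R n p p1) L0 L1).
subst n.
have [H0 H1] := holder_space0 s.
exact: (r_nuclear_of_integrable n0 r01 delta01 ha hw2 p21 q21 eps0 epsk erefl epsr
  (@holder_integrable R s s0) (@holder_unit_ball R s s0) H0 H1).
Qed.
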